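(* Let $\Omega\subset\mathbb{C}^n$ be a bounded hyperconvex domain with $0\in\Omega$. For $\varepsilon\in A$ let $S_\varepsilon=\{a_1^\varepsilon,\dots,a_N^\varepsilon\}\subset\Omega$ be a set of $N$ distinct points, all tending to $0$ as $\varepsilon\to0$, and let $\mathcal{I}_\varepsilon=\mathcal{I}(S_\varepsilon)$, so that $\ell(\mathcal{I}_\varepsilon)=N$ for every $\varepsilon$. (i) Let $\mathcal{I}:=\limsup_\varepsilon\mathcal{I}_\varepsilon$. If $\ell(\mathcal{I})\ge N$ (or equivalently $\ell(\mathcal{I})=N$), then $\lim_\varepsilon\mathcal{I}_\varepsilon=\mathcal{I}$. (ii) Let $\mathcal{I}:=\liminf_\varepsilon\mathcal{I}_\varepsilon$. If $\ell(\mathcal{I})\le N$ (or equivalently $\ell(\mathcal{I})=N$), then $\lim_\varepsilon\mathcal{I}_\varepsilon=\mathcal{I}$.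
   Context: $A\subset\mathbb{C}$ is a set with $0\in\overline{A}\setminus A$; all limits as $\varepsilon\to0$ are taken along $\varepsilon\in A$. $\mathcal{O}(\Omega)$ is the ring of holomorphic functions on $\Omega$. For a finite set $S\subset\Omega$, $\mathcal{I}(S)$ is the ideal of all $f\in\mathcal{O}(\Omega)$ vanishing on $S$. The length of an ideal $\mathcal{I}\subset\mathcal{O}(\Omega)$ is $\ell(\mathcal{I})=\dim_{\mathbb{C}}\mathcal{O}(\Omega)/\mathcal{I}$. For a family of ideals $(\mathcal{I}_\varepsilon)$: $\liminf_\varepsilon\mathcal{I}_\varepsilon$ is the ideal of all $f\in\mathcal{O}(\Omega)$ for which there are $f_\varepsilon\in\mathcal{I}_\varepsilon$ with $f_\varepsilon\to f$ locally uniformly on $\Omega$ as $\varepsilon\to0$; $\limsup_\varepsilon\mathcal{I}_\varepsilon$ is the ideal generated by all $f$ such that $f_j\to f$ locally uniformly for some sequence $\varepsilon_j\to0$ in $A$ and $f_j\in\mathcal{I}_{\varepsilon_j}$. If these coincide, the family converges and $\lim_\varepsilon\mathcal{I}_\varepsilon$ is the common value. *)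

(* Defs.v *)
From HB Require Import structures.
From mathcomp Require Import all_boot all_order all_algebra.
From mathcomp Require Import complex.
From mathcomp Require Import all_classical all_reals all_analysis.

Set Implicit Arguments.
Unset Strict Implicit.
Unset Printing Implicit Defensive.

Import Order.TTheory GRing.Theory Num.Theory numFieldNormedType.Exports.

Local Open Scope classical_set_scope.
Local Open Scope ring_scope.

(* The ascription to a numeric field is what gives R[i] its normed topology;
   the bare type R[i] has no canonical one. *)
Definition Cx (R : realType) : numClosedFieldType := R[i]%C.

Section Hyperconvex.
Variables (R : realType) (n : nat).
Implicit Types (Omega : set 'rV[Cx R]_n) (u : 'rV[Cx R]_n -> \bar R).

Definition expi (t : R) : Cx R := (cos t +i* sin t)%C.

(* Only the values of u on Omega matter, Omega being open.  The mean value
   inequality is over every closed disc of a complex line contained in Omega;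
   the integral is well defined in [-oo, +oo[, u being bounded above on the
   compact disc. *)
Definition plurisubharmonic Omega u :=
  [/\ forall z, Omega z -> (u z < +oo)%E,
      forall z, Omega z -> forall a : R, (u z < a%:E)%E ->
        \forall w \near z, (u w < a%:E)%E
    & forall z w : 'rV[Cx R]_n,
        (forall c : Cx R, `|c| <= 1 -> Omega (z + c *: w)) ->
        (u z <= ((2 * pi)^-1)%:E *
           \int[lebesgue_measure]_(t in `[0%R, (2 * pi)%R])
             u (z + expi t *: w)%R)%E ].

Definition hyperconvex Omega :=
  exists u : 'rV[Cx R]_n -> R,
    [/\ forall z, Omega z -> {for z, continuous u},
        plurisubharmonic Omega (EFin \o u),
        forall z, Omega z -> u z < 0
      & forall c : R, c < 0 ->
          exists K, [/\ compact K, K `<=` Omega &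
                        [set z | Omega z /\ u z < c] `<=` K] ].

Definition bounded_hyperconvex_domain Omega :=
  [/\ Omega !=set0, open Omega, connected Omega, bounded_set Omega
    & hyperconvex Omega].

End Hyperconvex.

Section Holomorphic.
Variables (R : realType) (n : nat) (Omega : set 'rV[Cx R]_n).

(* A function on Omega is holomorphic when some (equivalently, for Omega open,
   any) extension of it to C^n is complex differentiable at every point of
   Omega. *)
Definition holomorphic : {pred Omega -> Cx R} :=
  fun f => `[< exists2 g : 'rV[Cx R]_n -> Cx R,
    (forall z, Omega z -> differentiable g z) &
    forall z : Omega, f z = g (val z) >].

Fact holomorphic_subring : subring_closed holomorphic.
Proof.
split => [|f g|f g].
- apply/asboolP; exists (cst 1) => // z _; exact: differentiable_cst.
- move=> /asboolP[f' df ff'] /asboolP[g' dg gg']; apply/asboolP.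
  exists (f' - g') => [z Oz|z]; first exact: differentiableB (df _ Oz) (dg _ Oz).
  by rewrite !fctE ff' gg'.
- move=> /asboolP[f' df ff'] /asboolP[g' dg gg']; apply/asboolP.
  exists (f' * g') => [z Oz|z]; first exact: differentiableM (df _ Oz) (dg _ Oz).
  by rewrite !fctE ff' gg'.
Qed.

Fact holomorphic_scaler : GRing.scaler_closed holomorphic.
Proof.
move=> a f /asboolP[f' df ff']; apply/asboolP.
exists (a *: f') => [z Oz|z]; first exact: differentiableZ (df _ Oz).
by rewrite !fctE ff'.
Qed.

HB.instance Definition _ := GRing.isSubringClosed.Build _ holomorphic
  holomorphic_subring.
HB.instance Definition _ := GRing.isScaleClosed.Build _ _ holomorphic
  holomorphic_scaler.

Record holo := Holo {
  holo_fun :> Omega -> Cx R;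
  holoP : holo_fun \in holomorphic
}.

HB.instance Definition _ := [isSub for holo_fun].
HB.instance Definition _ := [Choice of holo by <:].
HB.instance Definition _ :=
  GRing.SubChoice_isSubComPzRing.Build _ _ holo (GRing.subringClosedP _).
HB.instance Definition _ := [SubZmodule_isSubLmodule of holo by <:].

End Holomorphic.

Section Ideals.
Variables (R : realType) (n : nat) (Omega : set 'rV[Cx R]_n).
Local Notation O := (holo Omega).
Implicit Types (I J : set O) (A : set (Cx R)) (Is : Cx R -> set O).

(* The library's idealr is restricted to proper ideals; here an ideal may be
   the whole ring. *)
Definition is_ideal I :=
  [/\ I 0, forall f g, I f -> I g -> I (f + g)
    & forall g f, I f -> I (g * f)].

Definition ideal_gen (F : set O) : set O := smallest is_ideal F.

Definition vanishing_ideal (S : set 'rV[Cx R]_n) : set O :=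
  [set f | forall z : Omega, S (val z) -> f z = 0].

(* The classes of the b i form a basis of the complex vector space O / I. *)
Definition quotient_basis I (k : nat) (b : 'I_k -> O) :=
  (forall c : 'I_k -> Cx R, I (\sum_(i < k) c i *: b i) -> forall i, c i = 0) /\
  (forall f, exists c : 'I_k -> Cx R, I (f - \sum_(i < k) c i *: b i)).

(* dim_C O / I: the size of any finite basis, +oo if there is none (the
   infimum of the empty set). *)
Definition ideal_length I : \bar R :=
  ereal_inf [set k%:R%:E | k in [set k : nat | exists b : 'I_k -> O,
                                   quotient_basis I b]].

Definition cvg_locally_uniformly {T : Type} (F : set_system T)
    (f_ : T -> O) (f : O) :=
  forall z : Omega, exists2 U : set Omega, nbhs z U &
    {uniform U, (fun t => f_ t : Omega -> Cx R) @ F --> (f : Omega -> Cx R)}.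

Definition ideal_liminf A Is : set O :=
  [set f | exists2 f_ : Cx R -> O, (forall e, A e -> Is e (f_ e)) &
     cvg_locally_uniformly (within A (nbhs 0)) f_ f].

Definition ideal_limsup A Is : set O :=
  ideal_gen [set f | exists (e : nat -> Cx R) (f_ : nat -> O),
    [/\ forall j, A (e j), e j @[j --> \oo] --> 0,
        forall j, Is (e j) (f_ j) & cvg_locally_uniformly \oo f_ f]].

Definition ideal_cvg_to A Is I :=
  ideal_liminf A Is = I /\ ideal_limsup A Is = I.

End Ideals.

Arguments vanishing_ideal {R n} Omega S.

(* Main.v *)
(* Everything rests on one estimate: N points near 0 impose N independent conditions on
   holomorphic functions, uniformly as the points collide.  Newton interpolation, one
   coordinate at a time, replaces f at the points by a polynomial of bounded degree whose
   coefficients are at most K sup |f| over a fixed polydisc, with K independent of the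
   points.  In one variable this bounds divided differences, by the maximum principle
   applied to the successive quotients (g z - g x) / (z - x).  The maximum principle comes
   from the mean value property: by Goursat's lemma in logarithmic polar coordinates the
   means of g over circles about p do not depend on the radius, and they tend to g p.
   Consequently the liminf of the ideals along any sequence has codimension at least N.
   Dually, N + 1 functions are always dependent modulo I_e, and compactness of the
   normalized coefficients makes them dependent modulo the limsup, which therefore has
   codimension at most N.
   (i) If b is a basis modulo the limsup and f lies in the limsup, write a normalized
   relation c_0 f + sum c_i b_i in I_e; every cluster point of c has c_i = 0 for i > 0, so
   f + sum (c_i / c_0) b_i in I_e converges to f.
   (ii) If b is a basis modulo the liminf and f is a limit along a sequence, write
   f = sum c_i b_i modulo the liminf; the liminf along that sequence also has codimension
   at least N and contains sum c_i b_i, so c = 0. *)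
Require Import Defs.
From mathcomp Require Import all_boot all_order all_algebra.
From mathcomp Require Import complex.
From mathcomp Require Import all_classical all_reals all_analysis.
From mathcomp Require Import lra ring zify.

Set Implicit Arguments.
Unset Strict Implicit.
Unset Printing Implicit Defensive.

Import Order.TTheory GRing.Theory Num.Theory numFieldNormedType.Exports.
Import Normc.

Local Open Scope classical_set_scope.
Local Open Scope ring_scope.

(** * Goursat's lemma on rectangles *)

Section Integral.
Variable R : realType.
Implicit Types (f g : R -> R) (a b m M : R).

Definition itvint f a b : R := \int[lebesgue_measure]_(x in `[a, b]) f x.

Definition cont_on f a b := forall x, a <= x <= b -> {for x, continuous f}.

Lemma cont_on_integrable f a b : cont_on f a b ->
  lebesgue_measure.-integrable `[a, b] (EFin \o f).
Proof.
move=> cf; apply: continuous_compact_integrable; first exact: segment_compact.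
apply: continuous_in_subspaceT => x; rewrite inE /= in_itv /= => xab; exact: cf.
Qed.

Lemma itvint_split f a m b : a <= m <= b -> cont_on f a b ->
  itvint f a b = itvint f a m + itvint f m b.
Proof.
move=> /andP[am mb] cf; rewrite /itvint.
have intf := cont_on_integrable cf.
rewrite -[LHS](subrK (itvint f a m)) addrC; congr (_ + _).
rewrite /itvint Rintegral_itvB ?bnd_simp //.
rewrite Rintegral_itv_obnd_cbnd //.
apply: integrableS intf => //.
by apply: subset_itvr; rewrite bnd_simp.
Qed.

Lemma itvintB f g a b : cont_on f a b -> cont_on g a b ->
  itvint (fun x => f x - g x) a b = itvint f a b - itvint g a b.
Proof. by move=> cf cg; rewrite /itvint RintegralB//; exact: cont_on_integrable. Qed.

Lemma itvint_cst k a b : a <= b -> itvint (fun=> k) a b = k * (b - a).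
Proof.
move=> ab; rewrite /itvint Rintegral_cst//; congr (_ * _).
have /= -> := @lebesgue_measure_itv R `[a, b]; rewrite lte_fin.
by case: ltP => //= ba; apply/eqP; rewrite eq_sym subr_eq0 eq_le ab ba.
Qed.

Lemma le_itvint f g a b : cont_on f a b -> cont_on g a b ->
  (forall x, a <= x <= b -> f x <= g x) -> itvint f a b <= itvint g a b.
Proof.
by move=> cf cg fg; apply: le_Rintegral => //; exact: cont_on_integrable.
Qed.

Lemma itvint_near_cst f a b k M : a <= b -> cont_on f a b ->
  (forall x, a <= x <= b -> `|f x - k| <= M) ->
  `|itvint f a b - k * (b - a)| <= M * (b - a).
Proof.
move=> ab cf fkM.
have cst_on l : cont_on (fun=> l) a b by move=> x _; exact: cst_continuous.
rewrite ler_distl -mulrBl -mulrDl -!itvint_cst//; apply/andP; split;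
  by apply: le_itvint => // x /fkM; rewrite ler_distl => /andP[].
Qed.

End Integral.

(** * Induction on rectangles by repeated bisection *)

Section Bisection.
Variable R : realType.

Definition subrect (q p : R * R * (R * R)) :=
  [/\ p.1.1 <= q.1.1, q.1.1 <= q.1.2 & q.1.2 <= p.1.2] /\
  [/\ p.2.1 <= q.2.1, q.2.1 <= q.2.2 & q.2.2 <= p.2.2].

(** If [P] failed on the whole rectangle, it would fail on a quarter of every failing rectangle. The
    nested failing rectangles shrink to a point, and there the local hypothesis is contradicted. *)
Lemma bisection_induction (P : R * R * (R * R) -> Prop) (a b c d : R) :
  a <= b -> c <= d ->
  (forall a1 b1 c1 d1 m l, subrect ((a1, b1), (c1, d1)) ((a, b), (c, d)) ->
    m = (a1 + b1) / 2 -> l = (c1 + d1) / 2 ->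
    P ((a1, m), (c1, l)) -> P ((m, b1), (c1, l)) ->
    P ((a1, m), (l, d1)) -> P ((m, b1), (l, d1)) -> P ((a1, b1), (c1, d1))) ->
  (forall x y, a <= x <= b -> c <= y <= d -> exists2 e : R, 0 < e &
    forall a1 b1 c1 d1, subrect ((a1, b1), (c1, d1)) ((a, b), (c, d)) ->
      a1 <= x <= b1 -> c1 <= y <= d1 -> b1 - a1 < e -> d1 - c1 < e ->
      P ((a1, b1), (c1, d1))) ->
  P ((a, b), (c, d)).
Proof.
move=> ab cd Psplit Ploc; apply: contrapT => nP.
pose Q0 := ((a, b), (c, d)).
pose bad q := subrect q Q0 /\ ~ P q.
pose half (q q' : R * R * (R * R)) := [/\ subrect q' q,
  q'.1.2 - q'.1.1 = (q.1.2 - q.1.1) / 2 & q'.2.2 - q'.2.1 = (q.2.2 - q.2.1) / 2].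
(* The implication sits under the existential, with default [q], so that [choice] yields a total map
   that can be iterated. *)
have step (q : R * R * (R * R)) : exists q', bad q -> bad q' /\ half q q'.
  have [bq|nbq] := pselect (bad q); last by exists q.
  apply: contrapT => /forallNP noq'; case: (bq) => sq nPq.
  move: q sq nPq bq noq' => [[a1 b1] [c1 d1]] sq nPq bq noq'.
  have [/= [? ? ?] [? ? ?]] := sq.
  apply: nPq; apply: (Psplit _ _ _ _ ((a1 + b1) / 2) ((c1 + d1) / 2)) => //;
   apply: contrapT => nPq';
   (apply: noq' => _; split; first (split; [|exact: nPq']; split; split=> /=; lra);
    split; [split; split| |] => /=; lra).
have [nx nxP] := choice step.
pose q n := iter n nx Q0.
have badq n : bad (q n).
  elim: n => [|n /nxP[]//]; split=> //; split; split=> //=; lra.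
have halfq n : half (q n) (q n.+1) by have [] := nxP _ (badq n).
have wd n : (q n).1.2 - (q n).1.1 = (b - a) * (2^-1) ^+ n.
  elim: n => [|n IH]; first by rewrite expr0 mulr1.
  by have [_ -> _] := halfq n; rewrite IH exprSr mulrA.
have hd n : (q n).2.2 - (q n).2.1 = (d - c) * (2^-1) ^+ n.
  elim: n => [|n IH]; first by rewrite expr0 mulr1.
  by have [_ _ ->] := halfq n; rewrite IH exprSr mulrA.
have sub_le n k : subrect (q (n + k)%N) (q n).
  elim: k => [|k IH].
    by rewrite addn0; have [[_ ? _] [_ ? _]] := (badq n).1; split; split.
  rewrite addnS; have [[[? ? ?] [? ? ?]] _ _] := halfq (n + k)%N.
  by case: IH => -[? ? ?] [? ? ?]; split; split=> //; lra.
(* Every left end lies below every right end, so the supremum of the left ends belongs to all the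
   nested intervals. *)
have crossx m n : (q m).1.1 <= (q n).1.2.
  have [[_ mm _] _] := (badq m).1; have [[_ nn _] _] := (badq n).1.
  have [mn|/ltnW nm] := leqP m n.
    by have := sub_le m (n - m)%N; rewrite subnKC// => -[[? ? ?] _]; lra.
  by have := sub_le n (m - n)%N; rewrite subnKC// => -[[? ? ?] _]; lra.
have crossy m n : (q m).2.1 <= (q n).2.2.
  have [_ [_ mm _]] := (badq m).1; have [_ [_ nn _]] := (badq n).1.
  have [mn|/ltnW nm] := leqP m n.
    by have := sub_le m (n - m)%N; rewrite subnKC// => -[_ [? ? ?]]; lra.
  by have := sub_le n (m - n)%N; rewrite subnKC// => -[_ [? ? ?]]; lra.
pose x := sup (range (fun n => (q n).1.1)).
pose y := sup (range (fun n => (q n).2.1)).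
have xin n : (q n).1.1 <= x <= (q n).1.2.
  apply/andP; split.
    apply: ub_le_sup; last by exists n.
    by exists (q 0).1.2 => _ [m _ <-].
  apply: ge_sup; first by exists (q 0).1.1, 0.
  by move=> _ [m _ <-].
have yin n : (q n).2.1 <= y <= (q n).2.2.
  apply/andP; split.
    apply: ub_le_sup; last by exists n.
    by exists (q 0).2.2 => _ [m _ <-].
  apply: ge_sup; first by exists (q 0).2.1, 0.
  by move=> _ [m _ <-].
have [e e0 eP] := Ploc x y (xin 0) (yin 0).
have small (w : R) : \forall n \near \oo, w * 2^-1 ^+ n < e.
  have : (fun n => w * 2^-1 ^+ n) @ \oo --> (0 : R).
    rewrite -[X in _ --> X](mulr0 w); apply: cvgM; first exact: cvg_cst.
    by apply: cvg_expr; rewrite ger0_norm; lra.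
  by move=> /cvgr_lt; apply.
near \oo => n.
have [sq nPq] := badq n; apply: nPq; rewrite (surjective_pairing (q n)).
rewrite (surjective_pairing (q n).1) (surjective_pairing (q n).2).
apply: eP => //.
- by rewrite wd; near: n; exact: small.
- by rewrite hd; near: n; exact: small.
Unshelve. all: by end_near. Qed.

End Bisection.

(** * The Cauchy-Riemann equations and integrals over the boundary of a rectangle *)

Section Goursat.
Variable R : realType.
Implicit Types U V : R -> R -> R.

(** Real differentiability at one point, with partial derivatives [A] and [B]. Nothing is asked of
    their continuity, which is why the boundary integral is handled by bisection and not by Green's
    formula. *)
Definition dif2 U (x0 y0 A B : R) := forall e : R, 0 < e ->
  exists2 d : R, 0 < d & forall x y, `|x - x0| < d -> `|y - y0| < d ->
    `|U x y - U x0 y0 - A * (x - x0) - B * (y - y0)| <= e * (`|x - x0| + `|y - y0|).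

Lemma dif2_cont U x0 y0 A B : dif2 U x0 y0 A B ->
  forall e : R, 0 < e -> exists2 d : R, 0 < d & forall x y, `|x - x0| < d ->
    `|y - y0| < d -> `|U x y - U x0 y0| < e.
Proof.
move=> dU e e0; have [d d0 dP] := dU 1 ltr01.
have k0 : 0 < `|A| + `|B| + 2 by have := normr_ge0 A; have := normr_ge0 B; lra.
pose d' := Num.min d (e / (2 * (`|A| + `|B| + 2))).
have d'0 : 0 < d' by rewrite lt_min d0 divr_gt0// mulr_gt0.
exists d' => // x y; rewrite !lt_min => /andP[xd xe] /andP[yd ye].
have := dP x y xd yd; rewrite mul1r => H.
have -> : U x y - U x0 y0 = (U x y - U x0 y0 - A * (x - x0) - B * (y - y0)) +
  A * (x - x0) + B * (y - y0) by ring.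
apply: le_lt_trans (ler_normD _ _) _.
apply: le_lt_trans (lerD (ler_normD _ _) (lexx _)) _.
rewrite !normrM.
move: xe ye; rewrite !ltr_pdivlMr ?mulr_gt0// => xe ye.
have := normr_ge0 A; have := normr_ge0 B.
have := normr_ge0 (x - x0); have := normr_ge0 (y - y0).
move: H xe ye; move: (`|A|) (`|B|) (`|x - x0|) (`|y - y0|) (`|_|) => a b u v t.
nra.
Qed.

Lemma dif2_contl U x0 y0 A B : dif2 U x0 y0 A B -> {for x0, continuous (U ^~ y0)}.
Proof.
move=> /dif2_cont dU; apply/cvgrPdist_lt => e /dU[d d0 dP].
apply/nbhs_normP; exists d => //= x /= xd.
by rewrite distrC; apply: dP; rewrite ?subrr ?normr0// distrC.
Qed.

Lemma dif2_contr U x0 y0 A B : dif2 U x0 y0 A B -> {for y0, continuous (U x0)}.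
Proof.
move=> /dif2_cont dU; apply/cvgrPdist_lt => e /dU[d d0 dP].
apply/nbhs_normP; exists d => //= x /= xd.
by rewrite distrC; apply: dP; rewrite ?subrr ?normr0// distrC.
Qed.

(* [A = U_x = V_y] is one of the two Cauchy-Riemann equations: the boundary integral below
   is the imaginary part of the contour integral of [U + iV]. *)
Lemma goursat_rectangle U V (a b c d : R) : a <= b -> c <= d ->
  (forall x y, a <= x <= b -> c <= y <= d ->
    exists A B B', dif2 U x y A B /\ dif2 V x y B' A) ->
  itvint (U b) c d - itvint (U a) c d =
  itvint (V ^~ d) a b - itvint (V ^~ c) a b.
Proof.
move=> ab cd dUV.
pose Q0 := ((a, b), (c, d)).
pose F (q : R * R * (R * R)) :=
  itvint (U q.1.2) q.2.1 q.2.2 - itvint (U q.1.1) q.2.1 q.2.2 -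
  (itvint (V ^~ q.2.2) q.1.1 q.1.2 - itvint (V ^~ q.2.1) q.1.1 q.1.2).
have cU x c1 d1 : a <= x <= b -> c <= c1 -> d1 <= d -> cont_on (U x) c1 d1.
  move=> xab cc1 dd1 y yc1; have /(dUV _ _ xab)[A [B [B' [H _]]]] : c <= y <= d by lra.
  exact: dif2_contr H.
have cV y a1 b1 : c <= y <= d -> a <= a1 -> b1 <= b -> cont_on (V ^~ y) a1 b1.
  move=> ycd aa1 bb1 x xa1; have xab : a <= x <= b by lra.
  have [A [B [B' [_ H]]]] := dUV _ _ xab ycd.
  exact: dif2_contl H.
(* Squares of the sides, because they behave like [F] under bisection: the four quarters have half
   the sides, and their bounds add up to the bound of the whole. *)
suff FQ0 (e : R) : 0 < e -> `|F Q0| <= 3 * e * ((b - a) ^+ 2 + (d - c) ^+ 2).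
  apply/eqP; rewrite -subr_eq0 -normr_le0 -[X in `|X|]/(F Q0).
  set K := (b - a) ^+ 2 + (d - c) ^+ 2 in FQ0.
  have K0 : 0 <= K by rewrite addr_ge0// sqr_ge0.
  rewrite leNgt; apply/negP => FQ.
  (* With this [e] the bound is half of [|F Q0|] times [K / (K + 1)], hence less than [|F Q0|]. *)
  have := FQ0 (`|F Q0| / (6 * (K + 1))).
  rewrite divr_gt0//; last by nra.
  move=> /(_ isT); rewrite mulrA mulrAC ler_pdivlMr; last by nra.
  by move: FQ; set f := `|_|; nra.
move=> e0.
apply: (@bisection_induction _ (fun q => `|F q| <=
   3 * e * ((q.1.2 - q.1.1) ^+ 2 + (q.2.2 - q.2.1) ^+ 2))) => //.
  move=> a1 b1 c1 d1 m l [/=[? ? ?] [? ? ?]] mE lE.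
  have am : a1 <= m <= b1 by rewrite mE; lra.
  have cl : c1 <= l <= d1 by rewrite lE; lra.
  rewrite /F /=.
  rewrite (@itvint_split _ (U b1) c1 l d1)//; last by apply: cU; lra.
  rewrite (@itvint_split _ (U a1) c1 l d1)//; last by apply: cU; lra.
  rewrite (@itvint_split _ (V ^~ c1) a1 m b1)//; last by apply: cV; lra.
  rewrite (@itvint_split _ (V ^~ d1) a1 m b1)//; last by apply: cV; lra.
  rewrite !ler_norml => /andP[? ?] /andP[? ?] /andP[? ?] /andP[? ?].
  have -> : (b1 - a1) ^+ 2 = 2 * (m - a1) ^+ 2 + 2 * (b1 - m) ^+ 2.
    by rewrite mE; field.
  have -> : (d1 - c1) ^+ 2 = 2 * (l - c1) ^+ 2 + 2 * (d1 - l) ^+ 2.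
    by rewrite lE; field.
  lra.
move=> x y xab ycd; have [A [B [B' [dU dV]]]] := dUV x y xab ycd.
have [d1 d10 dU1] := dU e e0; have [d2 d20 dV1] := dV e e0.
exists (Num.min d1 d2); first by rewrite lt_min d10.
move=> a1 b1 c1 d3 [/=[? ? ?] [? ? ?]] xa1 yc1.
rewrite !lt_min => /andP[w1 w2] /andP[h1 h2].
rewrite /F /= -itvintB; [|by apply: cU; lra..].
rewrite -itvintB; [|by apply: cV; lra..].
(* In the difference the value at [(x, y)] and the terms in [B] cancel. What remains is [A] times
   the area, and [H2] yields the same main term by the Cauchy-Riemann equation. *)
have H1 : `|itvint (fun t => U b1 t - U a1 t) c1 d3 - (A * (b1 - a1)) * (d3 - c1)| <=
   e * ((b1 - a1) + 2 * (d3 - c1)) * (d3 - c1).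
  apply: itvint_near_cst; first by lra.
    by move=> t tc; apply: continuousB; apply: (cU _ c1 d3) => //; lra.
  move=> t tc.
  have Hb : `|U b1 t - U x y - A * (b1 - x) - B * (t - y)| <=
     e * (`|b1 - x| + `|t - y|) by apply: dU1; rewrite ltr_norml; lra.
  have Ha : `|U a1 t - U x y - A * (a1 - x) - B * (t - y)| <=
     e * (`|a1 - x| + `|t - y|) by apply: dU1; rewrite ltr_norml; lra.
  have ty : `|t - y| <= d3 - c1 by rewrite ler_norml; lra.
  rewrite [`|b1 - x|]ger0_norm in Hb; last lra.
  rewrite [`|a1 - x|]ler0_norm in Ha; last lra.
  have -> : U b1 t - U a1 t - A * (b1 - a1) =
    (U b1 t - U x y - A * (b1 - x) - B * (t - y)) -
    (U a1 t - U x y - A * (a1 - x) - B * (t - y)) by ring.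
  apply: le_trans (ler_normB _ _) _; apply: le_trans (lerD Hb Ha) _.
  nra.
have H2 : `|itvint (fun t => V t d3 - V t c1) a1 b1 - (A * (d3 - c1)) * (b1 - a1)| <=
   e * ((d3 - c1) + 2 * (b1 - a1)) * (b1 - a1).
  apply: itvint_near_cst; first by lra.
    by move=> t tc; apply: continuousB; [apply: (cV d3 a1 b1)|apply: (cV c1 a1 b1)] => //; lra.
  move=> t tc.
  have Hb : `|V t d3 - V x y - B' * (t - x) - A * (d3 - y)| <=
     e * (`|t - x| + `|d3 - y|) by apply: dV1; rewrite ltr_norml; lra.
  have Ha : `|V t c1 - V x y - B' * (t - x) - A * (c1 - y)| <=
     e * (`|t - x| + `|c1 - y|) by apply: dV1; rewrite ltr_norml; lra.
  have tx : `|t - x| <= b1 - a1 by rewrite ler_norml; lra.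
  rewrite [`|d3 - y|]ger0_norm in Hb; last lra.
  rewrite [`|c1 - y|]ler0_norm in Ha; last lra.
  have -> : V t d3 - V t c1 - A * (d3 - c1) =
    (V t d3 - V x y - B' * (t - x) - A * (d3 - y)) -
    (V t c1 - V x y - B' * (t - x) - A * (c1 - y)) by ring.
  apply: le_trans (ler_normB _ _) _; apply: le_trans (lerD Hb Ha) _.
  nra.
set i1 := itvint _ _ _ in H1 *; set i2 := itvint _ _ _ in H2 *.
have -> : i1 - i2 = (i1 - A * (b1 - a1) * (d3 - c1)) - (i2 - A * (d3 - c1) * (b1 - a1)).
  by ring.
apply: le_trans (ler_normB _ _) _; apply: le_trans (lerD H1 H2) _.
set w := b1 - a1; set h := d3 - c1.
(* The two errors add up to [e] times [2 w^2 + 2 h^2 + 2 w h], and [2 w h <= w^2 + h^2] explains the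
   constant 3. *)
have : 0 <= e * (w - h) ^+ 2 by rewrite mulr_ge0 ?sqr_ge0// ltW.
nra.
Qed.

End Goursat.

(** * Complex numbers and the exponential *)

(** Over a general numeric field, so as to serve both the real functions exp, cos and sin and
    complex differentiation. *)
Lemma is_derive_expansion (K : numFieldType) (f : K -> K) (x l e : K) :
  is_derive x 1 f l -> 0 < e ->
  exists2 d : K, 0 < d & forall h, `|h| < d -> `|f (x + h) - f x - l * h| <= e * `|h|.
Proof.
move=> [dfx <-] e0.
have /cvgrPdist_le/(_ e e0) : h^-1 *: ((f \o shift x) (h *: 1) - f x) @[h --> 0^'] --> 'D_1 f x.
  exact: dfx.
move=> /nbhs_normP[/= d d0 dP]; exists d => // h hd.
have [->|h0] := eqVneq h 0; first by rewrite addr0 subrr mulr0 subr0 normr0 mulr0.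
have := dP h; rewrite /= sub0r normrN => /(_ hd h0) H.
rewrite -ler_pdivrMr ?normr_gt0// -normfV -normrM; apply: le_trans H.
rewrite distrC le_eqVlt; apply/orP; left; apply/eqP; congr `|_|.
by rewrite /= -[_ *: 1]/(h * 1) mulr1 [h + x]addrC -[_ *: _]/(_ * _); field.
Qed.

Section ComplexNumbers.
Variable R : realType.
Local Notation C := (Cx R).
Implicit Types z w : C.

(** The norm of [Cx R] takes its values in [Cx R]; with a modulus in [R] the estimates become real
    arithmetic. *)
Definition cabs z : R := normc z.
Definition cre z : R := complex.Re z.
Definition cim z : R := complex.Im z.
Definition cpx (x y : R) : C := (x +i* y)%C.

Lemma cpxE z : z = cpx (cre z) (cim z). Proof. by case: z. Qed.
Lemma cpxD x y x' y' : cpx x y + cpx x' y' = cpx (x + x') (y + y'). Proof. by []. Qed.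
Lemma cpxB x y x' y' : cpx x y - cpx x' y' = cpx (x - x') (y - y'). Proof. by []. Qed.
Lemma cpxM x y x' y' : cpx x y * cpx x' y' = cpx (x * x' - y * y') (x * y' + y * x').
Proof. by []. Qed.
Lemma cre_cpx x y : cre (cpx x y) = x. Proof. by []. Qed.
Lemma cim_cpx x y : cim (cpx x y) = y. Proof. by []. Qed.
Lemma cpx00 : cpx 0 0 = 0. Proof. by []. Qed.
Lemma cpx10 : cpx 1 0 = 1. Proof. by []. Qed.
Lemma creD z w : cre (z + w) = cre z + cre w. Proof. by case: z w => [? ?] []. Qed.
Lemma creB z w : cre (z - w) = cre z - cre w. Proof. by case: z w => [? ?] []. Qed.
Lemma cimB z w : cim (z - w) = cim z - cim w. Proof. by case: z w => [? ?] []. Qed.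

Lemma cabs_norm z : `|z| = cpx (cabs z) 0.
Proof. by []. Qed.

Lemma cpxr_lt x y : (cpx x 0 < cpx y 0) = (x < y).
Proof. exact: ltcR. Qed.
Lemma cpxr_le x y : (cpx x 0 <= cpx y 0) = (x <= y).
Proof. exact: lecR. Qed.

Lemma cpos_cpx (e : C) : 0 < e -> exists2 d : R, 0 < d & e = cpx d 0.
Proof. by case: e => a b; rewrite ltcE /= => /andP[/eqP -> a0]; exists a. Qed.

Lemma cabs_ge0 z : 0 <= cabs z.
Proof. by case: z => a b; exact: sqrtr_ge0. Qed.
Lemma cabsM z w : cabs (z * w) = cabs z * cabs w. Proof. exact: normcM. Qed.
Lemma cabsV z : cabs z^-1 = (cabs z)^-1. Proof. exact: normcV. Qed.
Lemma cabsD z w : cabs (z + w) <= cabs z + cabs w. Proof. exact: le_normcD. Qed.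
Lemma cabsN z : cabs (- z) = cabs z. Proof. exact: normcN. Qed.
Lemma cabsB z w : cabs (z - w) <= cabs z + cabs w.
Proof. by rewrite -(cabsN w); exact: cabsD. Qed.
Lemma cabs_distC z w : cabs (z - w) = cabs (w - z).
Proof. by rewrite -cabsN opprB. Qed.
Lemma cabs0 : cabs 0 = 0. Proof. exact: normc0. Qed.
Lemma cabs1 : cabs 1 = 1. Proof. exact: normc1. Qed.
Lemma cabs_eq0 z : (cabs z == 0) = (z == 0).
Proof. by apply/eqP/eqP => [/eq0_normc//|->]; rewrite cabs0. Qed.
Lemma cabs_gt0 z : (0 < cabs z) = (z != 0).
Proof. by rewrite lt_neqAle cabs_ge0 andbT eq_sym cabs_eq0. Qed.
Lemma cabs_sum (I : Type) (r : seq I) (P : pred I) (F : I -> C) :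
  cabs (\sum_(i <- r | P i) F i) <= \sum_(i <- r | P i) cabs (F i).
Proof.
elim/big_ind2 : _ => [|x1 x2 y1 y2 H1 H2|//]; first by rewrite cabs0.
by apply: le_trans (cabsD _ _) _; exact: lerD.
Qed.

Lemma cabs_cpx x y : cabs (cpx x y) <= `|x| + `|y|.
Proof.
rewrite /cabs /= -[leRHS]ger0_norm ?addr_ge0// -sqrtr_sqr ler_wsqrtr//.
rewrite sqrrD !real_normK ?num_real// lerD2r lerDl mulrn_wge0// mulr_ge0//.
Qed.
Lemma cabs_cpxr x : cabs (cpx x 0) = `|x|.
Proof. by rewrite /cabs /= expr0n addr0 sqrtr_sqr. Qed.
Lemma cre_le_cabs z : `|cre z| <= cabs z.
Proof. by case: z => a b; rewrite /cabs /= -sqrtr_sqr ler_wsqrtr// lerDl sqr_ge0. Qed.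
Lemma cim_le_cabs z : `|cim z| <= cabs z.
Proof. by case: z => a b; rewrite /cabs /= -sqrtr_sqr ler_wsqrtr// lerDr sqr_ge0. Qed.
Lemma cabs_sqr x y : cabs (cpx x y) ^+ 2 = x ^+ 2 + y ^+ 2.
Proof. by rewrite /cabs /= sqr_sqrtr// addr_ge0// sqr_ge0. Qed.

(** The witness is the conjugate of [z] divided by its modulus. This rotation turns bounds on a
    modulus into bounds on a real part. *)
Lemma cre_conj_norm z : exists2 l : C, cabs l = 1 & cre (l * z) = cabs z.
Proof.
have [->|z0] := eqVneq z 0; first by exists 1; rewrite ?cabs1// mulr0 cabs0.
have az0 : 0 < cabs z by rewrite cabs_gt0.
exists (cpx (cre z / cabs z) (- (cim z / cabs z))).
  apply: (@pexpIrn _ 2) => //; rewrite ?nnegrE ?cabs_ge0// expr1n cabs_sqr.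
  by rewrite sqrrN !exprMn -mulrDl -cabs_sqr -cpxE -exprMn divff ?gt_eqF// expr1n.
rewrite [X in _ * X](cpxE z) cpxM cre_cpx mulNr opprK -(mulrAC (cre z)) -(mulrAC (cim z)) -mulrDl.
by rewrite -!expr2 -cabs_sqr -cpxE expr2 mulfK// gt_eqF.
Qed.

Definition cdiff (g : C -> C) (p : C) := exists A : C, forall e : R, 0 < e ->
  exists2 d : R, 0 < d & forall z, cabs (z - p) < d ->
    cabs (g z - g p - A * (z - p)) <= e * cabs (z - p).

Definition ccont (g : C -> C) (p : C) := forall e : R, 0 < e ->
  exists2 d : R, 0 < d & forall z, cabs (z - p) < d -> cabs (g z - g p) < e.

(** The exponential of [s + i t]: in the coordinates [(s, t)] circles about the origin become
    segments with [s] constant. *)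
Definition expc (s t : R) : C := cpx (expR s * cos t) (expR s * sin t).

Lemma expcD s t s' t' : expc (s + s') (t + t') = expc s t * expc s' t'.
Proof. by rewrite /expc cpxM expRD cosD sinD; congr cpx; ring. Qed.

Lemma cabs_expc s t : cabs (expc s t) = expR s.
Proof.
apply: (@pexpIrn _ 2) => //; rewrite ?nnegrE ?cabs_ge0 ?expR_ge0//.
by rewrite cabs_sqr !exprMn -mulrDr cos2Dsin2 mulr1.
Qed.

Lemma expc_expansion0 (e : R) : 0 < e -> exists2 d : R, 0 < d & forall h k,
  `|h| < d -> `|k| < d -> cabs (expc h k - 1 - cpx h k) <= e * (`|h| + `|k|).
Proof.
(* The error terms add up to at most [e' (|h| + 5 |k|)], whence the 5; the bound 1 ensures
   [expR h <= 2]. *)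
move=> e0; pose e' := Num.min (e / 5) 1.
have e'0 : 0 < e' by rewrite lt_min ltr01 andbT divr_gt0.
have [d1 d10 P1] := is_derive_expansion (is_derive_expR (0 : R)) e'0.
have [d2 d20 P2] := is_derive_expansion (is_derive_cos (0 : R)) e'0.
have [d3 d30 P3] := is_derive_expansion (is_derive_sin (0 : R)) e'0.
pose d := Num.min (Num.min d1 (e' / 2)) (Num.min d2 d3).
exists d => [|h k]; first by rewrite !lt_min d10 d20 d30 divr_gt0.
rewrite !lt_min => /andP[/andP[hd1 he] _] /andP[_ /andP[kd2 kd3]].
have := P1 h hd1; have := P2 k kd2; have := P3 k kd3.
rewrite !add0r expR0 cos0 sin0 oppr0 !mul1r mul0r !subr0 addr0 => H3 H2 H1.
have e1 : e' <= 1 by rewrite ge_min lexx orbT.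
have e5 : 5 * e' <= e by rewrite mulrC -ler_pdivlMr// ge_min lexx.
have H4 : `|expR h - 1| <= e'.
  have -> : expR h - 1 = (expR h - 1 - h) + h by ring.
  apply: le_trans (ler_normD _ _) _.
  by have := normr_ge0 h; nra.
have H5 : expR h <= 2.
  by move: H4; rewrite ler_norml; lra.
have H50 := expR_ge0 h.
rewrite /expc -cpx10 !cpxB; apply: le_trans (cabs_cpx _ _) _.
have -> : expR h * cos k - 1 - h = (expR h - 1 - h) + expR h * (cos k - 1) by ring.
have -> : expR h * sin k - 0 - k = expR h * (sin k - k) + (expR h - 1) * k by ring.
apply: le_trans (lerD (ler_normD _ _) (ler_normD _ _)) _.
rewrite !normrM (ger0_norm H50).
have := normr_ge0 h; have := normr_ge0 k.
have := normr_ge0 (cos k - 1); have := normr_ge0 (sin k - k).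
move: H1 H2 H3 H4 H5 H50.
move: (expR h) (`|expR h - 1 - h|) (`|cos k - 1|) (`|sin k - k|) (`|expR h - 1|).
move: (`|h|) (`|k|) => a b u x y z t.
move=> H1 H2 H3 H4 H5 H50 z0 y0 b0 a0.
have : u * y <= 2 * (e' * b) by apply: ler_pM.
have : u * z <= 2 * (e' * b) by apply: ler_pM.
have : t * b <= e' * b by apply: ler_wpM2r.
nra.
Qed.

(** By the chain rule the derivative in [(s, t)] is multiplication by the complex number [c], the
    derivative of [g] times [expc s t]. Its real matrix has both diagonal entries equal to the real
    part of [c]: this is the shared [A]. *)
Lemma cdiff_expc g p s t : cdiff g (p + expc s t) ->
  exists A B B', dif2 (fun s t => cre (g (p + expc s t))) s t A B /\
                 dif2 (fun s t => cim (g (p + expc s t))) s t B' A.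
Proof.
move=> [D dg]; pose w := expc s t; pose c := D * w.
have main (e : R) : 0 < e -> exists2 d : R, 0 < d & forall x y,
    `|x - s| < d -> `|y - t| < d ->
    cabs (g (p + expc x y) - g (p + w) - c * cpx (x - s) (y - t)) <=
    e * (`|x - s| + `|y - t|).
  move=> e0.
  have w0 : 0 < cabs w by rewrite cabs_expc expR_gt0.
  have D0 := cabs_ge0 D.
  (* [e1] controls the expansion of the exponential and [e2] that of [g]; each contributes half of
     [e]. The bound 1 in [e1] gives [Q1']. *)
  pose e1 := Num.min 1 (e / (2 * (cabs D + 1) * cabs w)).
  have e10 : 0 < e1 by rewrite lt_min ltr01 divr_gt0// !mulr_gt0//; lra.
  pose e2 := e / (4 * cabs w).
  have e20 : 0 < e2 by rewrite divr_gt0// !mulr_gt0.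
  have [d1 d10 P1] := expc_expansion0 e10.
  have [d2 d20 P2] := dg e2 e20.
  pose d := Num.min d1 (d2 / (4 * cabs w)).
  exists d => [|x y]; first by rewrite lt_min d10 divr_gt0// mulr_gt0.
  rewrite !lt_min => /andP[xd xe] /andP[yd ye].
  have := P1 _ _ xd yd; set h := x - s; set k := y - t => Q1.
  have wxy : p + expc x y - (p + w) = w * (expc h k - 1).
    have -> : expc x y = w * expc h k by rewrite -expcD /h /k !subrKC.
    by ring.
  have hk : cabs (cpx h k) <= `|h| + `|k| := cabs_cpx h k.
  have e11 : e1 <= 1 by rewrite ge_min lexx.
  have e1e : e1 * (2 * (cabs D + 1) * cabs w) <= e.
    by rewrite -ler_pdivlMr ?ge_min ?lexx ?orbT// !mulr_gt0//; lra.
  have hk0 : 0 <= `|h| + `|k| by rewrite addr_ge0.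
  have Q1' : cabs (expc h k - 1) <= 2 * (`|h| + `|k|).
    have -> : expc h k - 1 = (expc h k - 1 - cpx h k) + cpx h k by ring.
    by apply: le_trans (cabsD _ _) _; nra.
  have Q2 : cabs (p + expc x y - (p + w)) <= cabs w * (2 * (`|h| + `|k|)).
    by rewrite wxy cabsM ler_wpM2l// ltW.
  have := P2 (p + expc x y).
  have Q3 : cabs (p + expc x y - (p + w)) < d2.
    apply: le_lt_trans Q2 _; move: xe ye; rewrite !ltr_pdivlMr ?mulr_gt0//.
    rewrite -/h -/k; lra.
  move=> /(_ Q3) Q4.
  have -> : g (p + expc x y) - g (p + w) - c * cpx h k =
    (g (p + expc x y) - g (p + w) - D * (p + expc x y - (p + w))) +
     c * (expc h k - 1 - cpx h k) by rewrite wxy /c; ring.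
  apply: le_trans (cabsD _ _) _; rewrite cabsM.
  have -> : e * (`|h| + `|k|) = e / 2 * (`|h| + `|k|) + e / 2 * (`|h| + `|k|) by field.
  apply: lerD.
    apply: le_trans Q4 _; apply: le_trans (ler_wpM2l (ltW e20) Q2) _.
    rewrite /e2 le_eqVlt; apply/orP; left; apply/eqP; field.
    by rewrite gt_eqF.
  rewrite /c cabsM; apply: le_trans (ler_wpM2l (mulr_ge0 D0 (ltW w0)) Q1) _.
  rewrite mulrA ler_wpM2r//.
  have : 0 <= e1 * cabs w by rewrite mulr_ge0// ltW.
  nra.
exists (cre c), (- cim c), (cim c); split => e /main[d d0 dP]; exists d => // x y xs yt.
  apply: le_trans (dP x y xs yt); apply: le_trans (cre_le_cabs _).
  rewrite !creB (cpxE c) cpxM cre_cpx le_eqVlt; apply/orP; left; apply/eqP.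
  by congr `|_|; rewrite cre_cpx cim_cpx; ring.
apply: le_trans (dP x y xs yt); apply: le_trans (cim_le_cabs _).
rewrite !cimB (cpxE c) cpxM cim_cpx le_eqVlt; apply/orP; left; apply/eqP.
by congr `|_|; rewrite cre_cpx cim_cpx; ring.
Qed.

End ComplexNumbers.

(** * The mean value property and the maximum principle *)

Section MaximumPrinciple.
Variable R : realType.
Local Notation C := (Cx R).
Implicit Types z w p : C.

Lemma nbhs_cabsP p (P : set C) :
  nbhs p P <-> exists2 d : R, 0 < d & forall z, cabs (z - p) < d -> P z.
Proof.
split=> [/nbhs_normP[/= e e0 eP]|[d d0 dP]].
  have [d d0 dE] := cpos_cpx e0; exists d => // z zp; apply: eP => /=.
  by rewrite cabs_norm cabs_distC dE cpxr_lt.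
apply/nbhs_normP; exists (cpx d 0); first by rewrite /= -cpx00 cpxr_lt.
by move=> z /=; rewrite cabs_norm cabs_distC cpxr_lt; exact: dP.
Qed.

Lemma ccontP g p : ccont g p <-> {for p, continuous g}.
Proof.
split=> [cg U /nbhs_cabsP[e e0 eU]|cg e e0].
  by apply/nbhs_cabsP; have [d d0 dP] := cg e e0; exists d => // z /dP /eU.
have /nbhs_cabsP[d d0 dP] : nbhs p (g @^-1` [set w | cabs (w - g p) < e]).
  by apply: cg; apply/nbhs_cabsP; exists e.
by exists d.
Qed.

Lemma cdiffP g p : cdiff g p <-> derivable g p 1.
Proof.
split=> [[A gA]|dg].
  apply/cvg_ex; exists A; apply/cvgrPdist_le => e e0.
  have [e' e'0 ->] := cpos_cpx e0; have [d d0 dP] := gA e' e'0.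
  apply/nbhs_cabsP; exists d => // h; rewrite subr0 => hd h0.
  have := dP (h + p); rewrite addrK => /(_ hd) H.
  rewrite cabs_norm cpxr_le -[_ *: (_ - _)]/(_ * (_ - _)) /= -[h *: 1]/(h * 1) mulr1.
  have -> : A - h^-1 * (g (h + p) - g p) = - (g (h + p) - g p - A * h) / h by field.
  by rewrite cabsM cabsN cabsV ler_pdivrMr// cabs_gt0.
exists ('D_1 g p) => e e0.
have e0' : 0 < cpx e 0 by rewrite -cpx00 cpxr_lt.
have [d /cpos_cpx[d' d'0 ->] dP] := is_derive_expansion (derivableP dg) e0'.
exists d' => // z zp; have := dP (z - p).
by rewrite !cabs_norm cpxr_lt subrKC cpxM !(mul0r, mulr0) !addr0 subr0 cpxr_le; exact.
Qed.

Lemma cdiff_ccont g p : cdiff g p -> ccont g p.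
Proof.
by move=> /cdiffP dg; apply/ccontP; apply: differentiable_continuous; exact/derivable1_diffP.
Qed.

Lemma cdiff_local f g p : (exists2 d : R, 0 < d & forall z, cabs (z - p) < d -> f z = g z) ->
  cdiff f p -> cdiff g p.
Proof.
move=> [d d0 fg] [A fA]; exists A => e /fA[d' d'0 d'P].
exists (Num.min d d'); first by rewrite lt_min d0.
move=> z; rewrite lt_min => /andP[zd zd'].
by rewrite -!fg ?subrr ?cabs0//; exact: d'P.
Qed.

Lemma ccont_local f g p : (exists2 d : R, 0 < d & forall z, cabs (z - p) < d -> f z = g z) ->
  ccont f p -> ccont g p.
Proof.
move=> [d d0 fg] cf e /cf[d' d'0 d'P].
exists (Num.min d d'); first by rewrite lt_min d0.
move=> z; rewrite lt_min => /andP[zd zd'].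
by rewrite -!fg ?subrr ?cabs0//; exact: d'P.
Qed.

Lemma continuous_cabs : continuous (@cabs R : C -> R).
Proof.
move=> p U /nbhs_ballP[e e0 eU]; apply/nbhs_cabsP; exists e => // z zp.
apply: eU; rewrite /ball /=.
apply: le_lt_trans zp; rewrite ler_norml; apply/andP; split.
  by rewrite lerBrDr addrC lerBlDr; have := cabsD (z - p) p; rewrite subrK addrC.
by rewrite cabs_distC lerBlDr; have := cabsD (p - z) z; rewrite subrK.
Qed.

Lemma continuous_cre : continuous (@cre R : C -> R).
Proof.
move=> p U /nbhs_ballP[e e0 eU]; apply/nbhs_cabsP; exists e => // z zp.
apply: eU; rewrite /ball /=.
by apply: le_lt_trans zp; rewrite -creB cabs_distC; exact: cre_le_cabs.
Qed.

Lemma continuous_cpx : continuous (fun xy : R * R => cpx xy.1 xy.2 : C).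
Proof.
move=> [x y] U /nbhs_cabsP[e e0 eU].
apply/nbhs_ballP; exists (e / 2); first by rewrite /= divr_gt0.
move=> [x' y'] [/= xx' yy']; apply: eU; rewrite cpxB.
apply: le_lt_trans (cabs_cpx _ _) _.
by move: xx' yy'; rewrite /ball /= (distrC x) (distrC y); lra.
Qed.

Lemma compact_cdisk (r : R) : compact [set z : C | cabs z <= r].
Proof.
apply: (@subclosed_compact _ _ ((fun xy : R * R => cpx xy.1 xy.2 : C) @`
    (`[- r, r] `*` `[- r, r]))).
- apply: (@closed_comp _ _ (@cabs R : C -> R) [set x | x <= r]); last exact: closed_le.
  by move=> z _; exact: continuous_cabs.
- apply: continuous_compact; first by apply: continuous_subspaceT; exact: continuous_cpx.
  by apply: compact_setX; exact: segment_compact.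
- move=> z /= zr; exists (cre z, cim z); last by rewrite -cpxE.
  by split; rewrite /= in_itv /= -ler_norml; apply: le_trans zr;
    [exact: cre_le_cabs|exact: cim_le_cabs].
Qed.

(** In logarithmic polar coordinates a rectangle covers an annulus, which avoids [p]. At the centre
    itself continuity is enough, to let the radius tend to 0. *)
Lemma mean_value_re g p (rho s : R) : ccont g p ->
  (forall z, z != p -> cabs (z - p) < rho -> cdiff g z) -> expR s < rho ->
  itvint (fun t => cre (g (p + expc s t))) 0 (2 * pi) = cre (g p) * (2 * pi).
Proof.
move=> cg dg srho.
have pi0 : 0 <= 2 * pi :> R by rewrite mulr_ge0// pi_ge0.
have dge s' t : s' <= s -> cdiff g (p + expc s' t).
  move=> ss'; apply: dg.
    by rewrite addrC -subr_eq0 addrK -cabs_eq0 cabs_expc gt_eqF// expR_gt0.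
  by rewrite addrC addKr cabs_expc (le_lt_trans _ srho)// ler_expR.
pose Phi s := itvint (fun t => cre (g (p + expc s t))) 0 (2 * pi).
have Phic s' : s' <= s -> Phi s' = Phi s.
  move=> ss'.
  have := @goursat_rectangle R (fun s t => cre (g (p + expc s t)))
    (fun s t => cim (g (p + expc s t))) s' s 0 (2 * pi) ss' pi0.
  (* The sides [t = 0] and [t = 2 pi] carry the same values by periodicity, so the right-hand side
     of Goursat's identity vanishes. *)
  have -> : (fun s => cim (g (p + expc s (2 * pi)))) = (fun s => cim (g (p + expc s 0))).
    apply/funext => x; rewrite /expc; have := @cos2pi R; have := @sin2pi R.
    by rewrite mulr_natl => -> ->; rewrite cos0 sin0.
  rewrite [RHS]subrr => H; have {}H : Phi s - Phi s' = 0.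
    by apply: H => x y /andP[_ xs] _; apply: cdiff_expc; exact: dge.
  by apply/eqP; rewrite eq_sym -subr_eq0 H.
apply/eqP; rewrite -subr_eq0 -normr_le0; apply/ler_addgt0Pl => e e0; rewrite addr0.
have k0 : 0 < 2 * pi + 1 :> R by rewrite ltr_wpDl.
have [d d0 dP] := cg (e / (2 * pi + 1)) (divr_gt0 e0 k0).
(* [expR a] is a radius below both [expR s] and the radius [d] given by continuity at [p]. *)
pose a := Num.min s (ln (d / 2)).
have as_ : a <= s by rewrite ge_min lexx.
have ad : expR a < d.
  apply: (@le_lt_trans _ _ (d / 2)); last by rewrite ltr_pdivrMr// ltr_pMr// ltr1n.
  have d20 : 0 < d / 2 by rewrite divr_gt0.
  by rewrite -[leRHS]lnK ?posrE// ler_expR ge_min lexx orbT.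
rewrite -[itvint _ _ _]/(Phi s) -(Phic _ as_) -[X in _ * X](subr0 (2 * pi)).
apply: (@le_trans _ _ (e / (2 * pi + 1) * (2 * pi - 0))).
  apply: itvint_near_cst => //.
    move=> t _; have [A [B [B' [H _]]]] := cdiff_expc (dge a t as_).
    exact: dif2_contr H.
  move=> t _; rewrite -creB; apply: le_trans (cre_le_cabs _) _.
  by apply: ltW; apply: dP; rewrite addrC addKr cabs_expc.
by rewrite subr0 mulrAC ler_pdivrMr// ler_wpM2l// ?ltW//; lra.
Qed.

Lemma mean_value_le g p (rho s m : R) : ccont g p ->
  (forall z, z != p -> cabs (z - p) < rho -> cdiff g z) -> expR s < rho ->
  (forall t, cre (g (p + expc s t)) <= m) -> cre (g p) <= m.
Proof.
move=> cg dg srho gm; have pi0 : 0 < 2 * pi :> R by rewrite mulr_gt0// pi_gt0.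
rewrite -(ler_pM2r pi0) -(mean_value_re cg dg srho) -[X in m * X]subr0.
rewrite -itvint_cst; last exact: ltW.
apply: le_itvint => [t _|t _|t _]; [|exact: cst_continuous|exact: gm].
have dge : cdiff g (p + expc s t).
  apply: dg; last by rewrite addrC addKr cabs_expc.
  by rewrite addrC -subr_eq0 addrK -cabs_eq0 cabs_expc gt_eqF// expR_gt0.
by have [A [B [B' [H _]]]] := cdiff_expc dge; exact: dif2_contr H.
Qed.

Lemma cdiff_lin g p (l k : C) : cdiff g p -> cdiff (fun z => l * g z + k * z) p.
Proof.
move=> /cdiffP dg; apply/cdiffP.
have -> : (fun z => l * g z + k * z) = cst l * g + cst k * id by exact/funext.
have dlg := derivableM (derivable_cst l p 1) dg.
have dk := derivableM (derivable_cst k p 1) (@derivable_id _ _ p 1).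
exact (derivableD dlg dk).
Qed.

Lemma ccont_lin g p (l k : C) : ccont g p -> ccont (fun z => l * g z + k * z) p.
Proof.
move=> /ccontP cg; apply/ccontP.
have FF := nbhs_filter p.
have clg := cvgM (FF := FF) (@cvg_cst _ l _ (nbhs p) FF) cg.
have ck := cvgM (FF := FF) (@cvg_cst _ k _ (nbhs p) FF) cvg_id.
exact (cvgD (FF := FF) clg ck).
Qed.

(* Finitely many exceptional points, where only continuity is asked, are what makes the
   class stable under the division (g z - g x) / (z - x). *)
Definition punctured_holo (g : C -> C) (r : R) (E : seq C) :=
  (forall z, cabs z < r -> ccont g z) /\
  (forall z, cabs z < r -> z \notin E -> cdiff g z).

Lemma isolated (E : seq C) p : exists2 d : R, 0 < d &
  forall z, z != p -> cabs (z - p) < d -> z \notin E.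
Proof.
elim: E => [|x E [d d0 dP]]; first by exists 1.
have [->|xp] := eqVneq x p.
  by exists d => // z zp zd; rewrite inE (negbTE zp) dP.
exists (Num.min d (cabs (x - p))); first by rewrite lt_min d0 cabs_gt0 subr_eq0.
move=> z zp; rewrite lt_min => /andP[zd zx]; rewrite inE negb_or dP// andbT.
by apply: contraTneq zx => ->; rewrite ltxx.
Qed.

(** Adding a small multiple of [|z|^2] to the real part of a rotated [g] gives a function [u] whose
    maximum over the disc, if [M] were exceeded, would be interior. About that point [u] is, up to a
    constant, a real part with the mean value property plus a positive quadratic term, which is
    absurd. *)
Lemma maximum_principle g (r r' M : R) (E : seq C) : 0 < r -> r < r' ->
  punctured_holo g r' E -> (forall z, cabs z = r -> cabs (g z) <= M) ->
  forall z, cabs z <= r -> cabs (g z) <= M.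
Proof.
move=> r0 rr' [cg dg] gM p0 p0r; rewrite leNgt; apply/negP => Mg.
have [l l1 lg] := cre_conj_norm (g p0).
(* Small enough for [u] to stay below [cabs (g p0)] on the circle of radius [r], which keeps its
   maximum off the boundary. *)
pose eta := (cabs (g p0) - M) / (2 * r ^+ 2).
have r20 : 0 < r ^+ 2 by rewrite exprn_gt0.
have eta0 : 0 < eta by rewrite divr_gt0 ?subr_gt0// mulr_gt0.
have etar : eta * r ^+ 2 < cabs (g p0) - M.
  by rewrite /eta; have -> : (cabs (g p0) - M) / (2 * r ^+ 2) * r ^+ 2 = (cabs (g p0) - M) / 2;
    [field; rewrite gt_eqF|lra].
pose u z := cre (l * g z) + eta * cabs z ^+ 2.
have [||p] := @compact_EVT_max _ R u [set z : C | cabs z <= r] _ (@compact_cdisk r).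
- by exists p0.
- apply: continuous_in_subspaceT => z; rewrite inE /= => zr.
  have /ccontP cgz : ccont g z by apply: cg; exact: le_lt_trans zr rr'.
  have FF := nbhs_filter z.
  have clg := cvgM (FF := FF) (@cvg_cst _ l _ (nbhs z) FF) cgz.
  have cu1 := continuous_comp clg (@continuous_cre _).
  have cu2 := continuous_comp (@continuous_cabs z) (@exprn_continuous R 2 _).
  exact (cvgD (FF := FF) cu1 (cvgM (FF := FF) (@cvg_cst _ eta _ (nbhs z) FF) cu2)).
rewrite inE /= => pr pmax.
have up : cabs (g p0) <= u p.
  apply: le_trans (pmax p0 _); last by rewrite inE.
  by rewrite /u lg lerDl mulr_ge0 ?sqr_ge0// ltW.
have p_lt : cabs p < r.
  rewrite lt_neqAle pr andbT; apply/eqP => prE.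
  have := gM p prE; have := cre_le_cabs (l * g p); rewrite cabsM l1 mul1r.
  by move: up; rewrite /u prE ler_norml => + /andP[_]; lra.
have [d d0 dE] := isolated E p.
pose rho := Num.min d (r - cabs p).
have rho0 : 0 < rho by rewrite lt_min d0 subr_gt0.
pose s := ln (rho / 2).
have sE : expR s = rho / 2 by rewrite lnK// posrE divr_gt0.
have in_r z : cabs (z - p) < rho -> cabs z < r.
  rewrite lt_min => /andP[_ zp]; rewrite -(subrK p z).
  by apply: le_lt_trans (cabsD _ _) _; rewrite -ltrBrDr.
pose k : C := 2 * cpx eta 0 * cpx (cre p) (- cim p).
have normE z : cabs z ^+ 2 = cre z ^+ 2 + cim z ^+ 2 by rewrite {1}(cpxE z) cabs_sqr.
(* [|z|^2] expanded about [p]: the linear part is absorbed in [k], which is [2 eta] times the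
   conjugate of [p]. *)
have hE z : cre (l * g z + k * z) = u z + eta * cabs p ^+ 2 - eta * cabs (z - p) ^+ 2.
  rewrite creD /u !normE creB cimB (cpxE z).
  have -> : k = cpx (2 * eta * cre p) (- (2 * eta * cim p)).
    rewrite /k -(_ : cpx 2 0 = 2); last first.
      by rewrite -[2 in RHS]/(1 + 1) -cpx10 cpxD addr0.
    by rewrite !cpxM; congr cpx; ring.
  by rewrite -cpxE {2}(cpxE z) cpxM !cre_cpx; ring.
suff : cre (l * g p + k * p) <= u p + eta * cabs p ^+ 2 - eta * (rho / 2) ^+ 2.
  have : 0 < eta * (rho / 2) ^+ 2 by rewrite mulr_gt0// exprn_gt0// divr_gt0.
  by rewrite hE subrr cabs0 expr0n mulr0 subr0; lra.
apply: (@mean_value_le (fun z => l * g z + k * z) p rho s).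
- by apply: ccont_lin; apply: cg; apply: lt_trans rr'.
- move=> z zp zrho; apply: cdiff_lin; apply: dg.
    by apply: lt_trans rr'; exact: in_r.
  by apply: dE => //; move: zrho; rewrite lt_min => /andP[].
- by rewrite sE ltr_pdivrMr// ltr_pMr// ltr1n.
- move=> t; rewrite hE [p + _ - p]addrAC subrr add0r cabs_expc sE lerD2r// lerD2r.
  apply: pmax; rewrite inE; apply/ltW/in_r.
  by rewrite addrC addKr cabs_expc sE ltr_pdivrMr// ltr_pMr// ltr1n.
Qed.

End MaximumPrinciple.

(** * Bounded interpolation at finitely many points *)

Section NewtonInterpolation.
Variable R : realType.
Local Notation C := (Cx R).
Implicit Types (X E : seq C) (g h : C -> C) (x y z : C).

(** Newton's form with divided differences. At a repeated node the quotient takes the default value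
    0 of a division by zero, so interpolation asks for [uniq X]. *)
Fixpoint newton X g : {poly C} :=
  if X is x :: X' then
    (g x)%:P + ('X - x%:P) * newton X' (fun y => (g y - g x) / (y - x))
  else 0.

Lemma size_newton X g : (size (newton X g) <= size X)%N.
Proof.
elim: X g => [|x X IH] g /=; first by rewrite size_poly0.
apply: leq_trans (size_polyD _ _) _; rewrite geq_max; apply/andP; split.
  by apply: leq_trans (size_polyC_leq1 _) _.
apply: leq_trans (size_polyMleq _ _) _.
by rewrite size_XsubC !addSn add0n /= ltnS IH.
Qed.

Lemma eq_newton X g h : {in X, g =1 h} -> newton X g = newton X h.
Proof.
elim: X g h => [//|x X IH] g h gh /=; rewrite gh ?mem_head//; congr (_ + _ * _).
by apply: IH => y yX; rewrite !gh// inE ?eqxx// yX orbT.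
Qed.

Lemma horner_newton X g x : uniq X -> x \in X -> (newton X g).[x] = g x.
Proof.
elim: X g => [//|y X IH] g /= /andP[yX uX]; rewrite inE !hornerE => /predU1P[->|xX].
  by rewrite subrr mul0r addr0.
rewrite IH// mulrCA mulfV ?mulr1 ?subrKC// subr_eq0.
by apply: contraNneq yX => <-.
Qed.

(** The coefficients are linear combinations of the values at the nodes, with weights that depend
    only on the nodes. This makes them holomorphic in the remaining variables. *)
Lemma newton_closed (T : Type) (D : set (T -> C)) X (F : C -> T -> C) a :
  D (fun=> 0) -> (forall u v, D u -> D v -> D (fun t => u t + v t)) ->
  (forall c u, D u -> D (fun t => c * u t)) ->
  (forall x, x \in X -> D (F x)) -> D (fun t => (newton X (F ^~ t))`_a).
Proof.
move=> D0 DD DM; elim: X F a => [|x X IH] F a DF /=.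
  by rewrite (_ : (fun _ => _) = fun=> 0)//; apply/funext => t; rewrite coef0.
pose G y t := (F y t - F x t) / (y - x).
have DG b : D (fun t => (newton X (G ^~ t))`_b).
  apply: IH => y yX.
  rewrite (_ : G y = fun t => (y - x)^-1 * (F y t + (- 1) * F x t)).
    by apply: (DM); apply: (DD); [|apply: (DM)]; apply: DF; rewrite inE ?eqxx// yX orbT.
  by apply/funext => t; rewrite /G mulN1r mulrC.
rewrite (_ : (fun _ => _) = fun t => (if a == 0 then 1 else 0) * F x t +
   ((if a is b.+1 then (newton X (G ^~ t))`_b else 0) + - x * (newton X (G ^~ t))`_a)).
  apply: (DD); first by apply: (DM); apply: DF; exact: mem_head.
  by apply: (DD); [case: a => [|b]; [exact: D0|exact: DG]|exact: DM].
apply/funext => t; rewrite coefD coefC mulrBl coefB coefXM coefCM mulNr.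
by case: a => [|a] /=; rewrite ?mul1r ?mul0r.
Qed.

(** Taking the derivative as value at [x] makes the quotient continuous there; [x] joins the
    exceptional points, which avoids proving differentiability across a removable singularity. *)
Lemma punctured_holo_divided g r E x : cabs x < r -> x \notin E ->
  punctured_holo g r E -> exists2 h, punctured_holo h r (x :: E) &
    forall z, z != x -> h z = (g z - g x) / (z - x).
Proof.
move=> xr xE [cg dg]; have [A gA] := dg x xr xE.
pose h z := if z == x then A else (g z - g x) / (z - x).
have hE z : z != x -> h z = (g z - g x) / (z - x) by rewrite /h => /negbTE ->.
exists h => //.
have near_h z : z != x -> exists2 d : R, 0 < d & forall w, cabs (w - z) < d ->
    (g w - g x) / (w - x) = h w.
  move=> zx; exists (cabs (x - z)); first by rewrite cabs_gt0 subr_eq0 eq_sym.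
  by move=> w wz; rewrite hE//; apply: contraTneq wz => ->; rewrite ltxx.
split=> z zr.
  have [->|zx] := eqVneq z x; last first.
    apply: ccont_local (near_h z zx) _; apply/ccontP.
    have /ccontP cgz := cg z zr.
    have zx0 : z - x != 0 by rewrite subr_eq0.
    have FF := nbhs_filter z.
    have cn := cvgB (FF := FF) cgz (@cvg_cst _ (g x) _ (nbhs z) FF).
    have cd := cvgV (FF := FF) zx0 (cvgB (FF := FF) cvg_id (@cvg_cst _ x _ (nbhs z) FF)).
    exact (cvgM (FF := FF) cn cd).
  move=> e e0; have [d d0 dP] := gA (e / 2) (divr_gt0 e0 (ltr0Sn _ _)).
  exists d => // w wx; have [->|wnx] := eqVneq w x; first by rewrite subrr cabs0.
  rewrite hE// /h eqxx.
  have wx0 : w - x != 0 by rewrite subr_eq0.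
  have -> : (g w - g x) / (w - x) - A = (g w - g x - A * (w - x)) / (w - x) by field.
  rewrite cabsM cabsV ltr_pdivrMr ?cabs_gt0//; apply: le_lt_trans (dP _ wx) _.
  by rewrite ltr_pM2r ?cabs_gt0// ltr_pdivrMr// ltr_pMr// ltr1n.
rewrite inE negb_or => /andP[zx zE].
apply: cdiff_local (near_h z zx) _; apply/cdiffP.
have /cdiffP dgz := dg z zr zE.
have dgx := derivableB dgz (derivable_cst (g x) z 1).
have dzx := derivableB (@derivable_id _ _ z 1) (derivable_cst x z 1).
have zx0 : (id - cst x) z != 0 by rewrite subr_eq0.
exact (derivableM dgx (derivableV zx0 dzx)).
Qed.

(** One step of the recursion: the value [g x] contributes 1. The quotient is bounded by [4 M / r];
    its multiplication by the variable contributes [4 / r], and that by [x], of modulus at most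
    [r / 2], contributes 2. *)
Fixpoint newton_cst (r : R) k : R :=
  if k is k'.+1 then 1 + newton_cst r k' * (4 / r + 2) else 0.

Lemma newton_cst_ge0 r k : 0 < r -> 0 <= newton_cst r k.
Proof.
by move=> r0; elim: k => //= k IH; rewrite addr_ge0// mulr_ge0// addr_ge0// divr_ge0// ltW.
Qed.

Lemma newton_bound X g r r' M E a : 0 < r -> r < r' -> uniq X ->
  (forall x, x \in X -> x \notin E /\ cabs x <= r / 2) ->
  punctured_holo g r' E -> (forall z, cabs z <= r -> cabs (g z) <= M) ->
  cabs (newton X g)`_a <= newton_cst r (size X) * M.
Proof.
move=> r0 rr'; elim: X g M E a => [|x X IH] g M E a /=.
  by rewrite coef0 cabs0 mul0r.
move=> /andP[xX uX] XE hg gM.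
have [xE xr] := XE x (mem_head _ _).
have M0 : 0 <= M by apply: le_trans (cabs_ge0 (g 0)) (gM _ _); rewrite cabs0 ltW.
have [|h hh hE] := @punctured_holo_divided g r' E x _ xE hg; first by lra.
have -> : newton X (fun y => (g y - g x) / (y - x)) = newton X h.
  by apply: eq_newton => y yX; rewrite hE//; apply: contraNneq xX => <-.
(* On the circle of radius [r] the denominator is at least [r / 2] and the numerator at most [2 M];
   the maximum principle carries the bound inside. *)
have hM : forall z, cabs z <= r -> cabs (h z) <= 4 * M / r.
  apply: maximum_principle hh _ => // z zr.
  have zx : r / 2 <= cabs (z - x).
    by have := cabsD (z - x) x; rewrite subrK zr; lra.
  have zx0 : z != x by rewrite -subr_eq0 -cabs_gt0; lra.
  rewrite hE// cabsM cabsV ler_pdivrMr ?cabs_gt0 ?subr_eq0//.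
  apply: le_trans (cabsB _ _) _; apply: (@le_trans _ _ (M + M)).
    by apply: lerD; apply: gM; lra.
  apply: (@le_trans _ _ (4 * M / r * (r / 2))); last first.
    by rewrite ler_wpM2l// divr_ge0 ?mulr_ge0// ltW.
  by rewrite le_eqVlt; apply/orP; left; apply/eqP; field; rewrite gt_eqF.
have {}IH b : cabs (newton X h)`_b <= newton_cst r (size X) * (4 * M / r).
  apply: IH hh hM => // y yX; have [|yE yr] := XE y; first by rewrite inE yX orbT.
  by rewrite inE negb_or yE yr andbT; split=> //; apply: contraNneq xX => <-.
set K := newton_cst r (size X) in IH *.
have K0 : 0 <= K by exact: newton_cst_ge0.
have KM : 0 <= K * (4 * M / r) by rewrite mulr_ge0// divr_ge0 ?mulr_ge0// ltW.
have -> : (1 + K * (4 / r + 2)) * M = M + (K * (4 * M / r) + r / 2 * (K * (4 * M / r))).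
  by field; rewrite gt_eqF.
rewrite coefD coefC mulrBl coefB coefXM coefCM.
apply: le_trans (cabsD _ _) _; apply: lerD.
  by case: ifP => _; rewrite ?cabs0//; apply: gM; lra.
apply: le_trans (cabsB _ _) _; apply: lerD; first by case: ifP => _; rewrite ?cabs0.
by rewrite cabsM; apply: ler_pM => //; exact: cabs_ge0.
Qed.

End NewtonInterpolation.

(** * Interpolation in several variables, one coordinate at a time *)

Section TensorInterpolation.
Variables (R : realType) (n : nat).
Local Notation C := (Cx R).
Local Notation V := 'rV[C]_n.
Implicit Types (z w : V) (F G : V -> C).

Definition upd z (i : 'I_n) (t : C) : V := \row_j (if j == i then t else z 0 j).

Definition polydisc (r : R) : set V := [set z | forall i, cabs (z 0 i) < r].
Definition cpolydisc (r : R) : set V := [set z | forall i, cabs (z 0 i) <= r].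

(** Holomorphy in each variable separately: it is what one-variable interpolation uses, and it
    survives freezing a coordinate. *)
Definition sepholo (r : R) F := forall z i, polydisc r z ->
  cdiff (fun t => F (upd z i t)) (z 0 i).

Lemma upd_id z i : upd z i (z 0 i) = z.
Proof. by apply/rowP => j; rewrite mxE; case: eqP => // ->. Qed.

Lemma updK z i t u : upd (upd z i t) i u = upd z i u.
Proof. by apply/rowP => j; rewrite !mxE; case: eqP. Qed.

Lemma updC z i j t u : i != j -> upd (upd z i t) j u = upd (upd z j u) i t.
Proof.
by move=> ij; apply/rowP => k; rewrite !mxE; case: eqP => // ->; rewrite eq_sym (negbTE ij).
Qed.

Lemma sepholo_cst r c : sepholo r (fun=> c).
Proof. by move=> z i _; apply/cdiffP; exact: derivable_cst. Qed.

Lemma sepholoD r F G : sepholo r F -> sepholo r G -> sepholo r (fun z => F z + G z).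
Proof.
move=> hF hG z i zr; apply/cdiffP.
have /cdiffP dF := hF z i zr; have /cdiffP dG := hG z i zr.
exact (derivableD dF dG).
Qed.

Lemma sepholoZ r c F : sepholo r F -> sepholo r (fun z => c * F z).
Proof.
move=> hF z i zr; apply/cdiffP; have /cdiffP dF := hF z i zr.
exact (derivableM (derivable_cst c _ _) dF).
Qed.

Lemma polydisc_upd r z i t : polydisc r z -> cabs t < r -> polydisc r (upd z i t).
Proof. by move=> zr tr j; rewrite mxE; case: eqP. Qed.

Lemma cpolydisc_upd r z i t : cpolydisc r z -> cabs t <= r -> cpolydisc r (upd z i t).
Proof. by move=> zr tr j; rewrite mxE; case: eqP. Qed.

Lemma sepholo_upd r F i t : cabs t < r -> sepholo r F -> sepholo r (fun z => F (upd z i t)).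
Proof.
move=> tr hF z j zr; have [->|ji] := eqVneq j i.
  under eq_fun do rewrite updK; apply/cdiffP; exact: derivable_cst.
under eq_fun do rewrite (updC _ _ _ ji).
have := hF (upd z i t) j (polydisc_upd i zr tr).
by rewrite mxE (negbTE ji).
Qed.

Definition depends_on (s : seq 'I_n) F :=
  forall z w, (forall i, i \in s -> z 0 i = w 0 i) -> F z = F w.

(** Induction on the coordinates: the Newton coefficients in coordinate [i] are bounded functions of
    the others, to which the induction hypothesis applies. The order of the quantifiers matters: the
    monomials precede the radius, and [K] precedes the points. *)
Lemma bounded_interpolation_on (N : nat) (s : seq 'I_n) :
  exists (J : finType) (mon : J -> V -> C), (forall j z, differentiable (mon j) z) /\
    forall r : R, 0 < r -> exists2 K : R, 0 <= K &
      forall (r' : R) (X : 'I_n -> seq C) F M, r < r' ->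
        (forall i, uniq (X i) /\ (size (X i) <= N)%N) ->
        (forall i x, x \in X i -> cabs x <= r / 2) ->
        sepholo r' F -> depends_on s F ->
        (forall z, cpolydisc r z -> cabs (F z) <= M) ->
        exists tau : J -> C, (forall j, cabs (tau j) <= K * M) /\
          forall z, (forall i, z 0 i \in X i) -> F z = \sum_j tau j * mon j z.
Proof.
elim: s => [|i s [J [mon [dmon IH]]]].
  exists unit, (fun _ _ => 1); split=> // r r0.
  exists 1 => // r' X F M rr' XN Xr hF Fs FM.
  exists (fun=> F 0); split=> [_|z _].
    by rewrite mul1r; apply: FM => i; rewrite mxE cabs0 ltW.
  by rewrite big_const card_unit /= addr0 mulr1; apply: Fs.
exists ('I_N * J)%type, (fun (aj : 'I_N * J) z => z 0 i ^+ aj.1 * mon aj.2 z).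
split=> [j z|r r0].
  suff dX (a : nat) : differentiable (fun w : V => w 0 i ^+ a) z.
    exact: differentiableM (dX j.1) (dmon j.2 z).
  elim: a => [|a IHa]; first exact: differentiable_cst.
  rewrite (_ : (fun _ => _) = (fun w : V => w 0 i) * (fun w => w 0 i ^+ a)).
    exact: differentiableM (differentiable_coord _ _ _) IHa.
  by apply/funext => w; rewrite exprS.
have [K K0 {}IH] := IH r r0; have L0 k := newton_cst_ge0 k r0.
(* The sum dominates the constant for any number of nodes up to [N]. *)
pose L := \sum_(k < N.+1) newton_cst r k.
exists (K * L) => [|r' X F M rr' XN Xr hF Fs FM]; first by rewrite mulr_ge0// sumr_ge0.
have [uX sX] := XN i.
have M0 : 0 <= M.
  by apply: le_trans (cabs_ge0 (F 0)) (FM _ _) => j; rewrite mxE cabs0 ltW.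
(* The coefficient of degree [a] in coordinate [i]; that coordinate of [z] is overwritten, so [T a]
   depends only on [s]. *)
pose T (a : nat) z := (newton (X i) (fun y => F (upd z i y)))`_a.
have hT a : sepholo r' (T a).
  apply: (@newton_closed _ _ (sepholo r') (X i) (fun y z => F (upd z i y)) a).
  - exact: sepholo_cst.
  - exact: sepholoD.
  - exact: sepholoZ.
  - by move=> x /Xr xr; apply: sepholo_upd => //; lra.
have Ts a : depends_on s (T a).
  move=> z w zw; rewrite /T (@eq_newton _ _ _ (fun y => F (upd w i y)))// => y _ /=.
  by apply: Fs => j; rewrite inE !mxE; case: eqP => //= _; exact: zw.
have TM a z : cpolydisc r z -> cabs (T a z) <= L * M.
  move=> zr; apply: (@le_trans _ _ (newton_cst r (size (X i)) * M)); last first.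
    rewrite ler_wpM2r// /L (bigD1 (Ordinal (sX : (size (X i) < N.+1)%N)))//=.
    by rewrite lerDl sumr_ge0.
  apply: (@newton_bound _ _ _ r r' M [::]) => //.
  - by move=> x /Xr.
  - have dF t : cabs t < r' -> cdiff (fun y => F (upd z i y)) t.
      move=> tr'; have := hF (upd z i t) i; rewrite mxE eqxx.
      under eq_fun do rewrite updK.
      by apply; apply: polydisc_upd => // j; exact: le_lt_trans (zr j) rr'.
    by split=> t tr'; [apply: cdiff_ccont|move=> _]; exact: dF.
  - by move=> t tr; apply: FM; exact: cpolydisc_upd.
have /choice[tau tauP] (a : 'I_N) : exists tau : J -> C,
    (forall j, cabs (tau j) <= K * (L * M)) /\
    forall z, (forall i, z 0 i \in X i) -> T a z = \sum_j tau j * mon j z.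
  exact: (IH r' X (T a) (L * M)) (TM a).
exists (fun aj : 'I_N * J => tau aj.1 aj.2); split=> [[a j]|z zX].
  by rewrite -mulrA; exact: (tauP a).1.
rewrite -(pair_bigA _ (fun a j => tau a j * (z 0 i ^+ a * mon j z)))/=.
rewrite -{1}(upd_id z i) -(@horner_newton _ (X i) (fun y => F (upd z i y)))//.
rewrite (@horner_coef_wide _ N); last exact: leq_trans (size_newton _ _) sX.
apply: eq_bigr => a _; rewrite -[_`_a]/(T a z) (tauP a).2// mulr_suml.
by apply: eq_bigr => j _; rewrite mulrAC mulrA.
Qed.

(** The points lie on the grid of their coordinates. Distinct points may share a coordinate, hence
    the [undup]. *)
Lemma bounded_interpolation (N : nat) :
  exists (J : finType) (mon : J -> V -> C), (forall j z, differentiable (mon j) z) /\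
    forall r : R, 0 < r -> exists2 K : R, 0 <= K &
      forall (r' : R) (p : 'I_N -> V) F M, r < r' ->
        (forall l, cpolydisc (r / 2) (p l)) -> sepholo r' F ->
        (forall z, cpolydisc r z -> cabs (F z) <= M) ->
        exists tau : J -> C, (forall j, cabs (tau j) <= K * M) /\
          forall l, F (p l) = \sum_j tau j * mon j (p l).
Proof.
have [J [mon [dmon H]]] := bounded_interpolation_on N (enum 'I_n).
exists J, mon; split=> // r r0; have [K K0 {}H] := H r r0.
exists K => // r' p F M rr' pr hF FM.
pose X i := undup [seq p l 0 i | l <- enum 'I_N].
have [|||tau [tauK tauE]] := H r' X F M rr' _ _ hF _ FM.
- move=> i; rewrite undup_uniq; split=> //.
  by apply: leq_trans (size_undup _) _; rewrite size_map size_enum_ord.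
- by move=> i x; rewrite mem_undup => /mapP[l _ ->]; exact: pr.
- by move=> z w zw; congr F; apply/rowP => i; apply: zw; rewrite mem_enum.
exists tau; split=> // l; apply: tauE => i.
by rewrite mem_undup; apply: map_f; rewrite mem_enum.
Qed.

End TensorInterpolation.

(** * Codimension *)

Section Codimension.
Variables (K : fieldType) (V : lmodType K).
Implicit Types (I : set V) (k m : nat).

Definition subspace I :=
  [/\ I 0, forall u v, I u -> I v -> I (u + v) & forall c v, I v -> I (c *: v)].

(** With [free_mod], one of the two halves of [quotient_basis], expressed on representatives. *)
Definition spans_mod I k (b : 'I_k -> V) :=
  forall v, exists c : 'I_k -> K, I (v - \sum_(i < k) c i *: b i).

Definition free_mod I k (b : 'I_k -> V) :=
  forall c : 'I_k -> K, I (\sum_(i < k) c i *: b i) -> forall i, c i = 0.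

Lemma subspace_sum I (J : Type) (r : seq J) (P : pred J) (F : J -> V) :
  subspace I -> (forall j, P j -> I (F j)) -> I (\sum_(j <- r | P j) F j).
Proof. by move=> [I0 ID _] IF; elim/big_ind : _. Qed.

Lemma subspaceB I u v : subspace I -> I u -> I v -> I (u - v).
Proof. by move=> [_ ID IZ] Iu Iv; apply: ID => //; rewrite -scaleN1r; exact: IZ. Qed.

Lemma wide_kernel m k (M : 'I_k -> 'I_m -> K) : (m < k)%N ->
  exists c : 'I_k -> K, (exists i, c i != 0) /\ forall j, \sum_i c i * M i j = 0.
Proof.
move=> mk; pose A := \matrix_(i, j) M i j.
have /rowV0Pn[u /sub_kermxP uA u0] : kermx A != 0.
  by rewrite -mxrank_eq0 mxrank_ker subn_eq0 -ltnNge (leq_ltn_trans (rank_leq_col A)).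
exists (u 0); split.
  by move/rV0Pn : u0.
by move=> j; move/rowP/(_ j): uA; rewrite !mxE => uA; rewrite -[RHS]uA;
  apply: eq_bigr => i _; rewrite mxE.
Qed.

Lemma dependent_mod I m k (b : 'I_m -> V) (g : 'I_k -> V) : subspace I ->
  spans_mod I b -> (m < k)%N ->
  exists c : 'I_k -> K, (exists i, c i != 0) /\ I (\sum_i c i *: g i).
Proof.
move=> sI sb mk; have /choice[M gM] i := sb (g i).
have [c [c0 cM]] := wide_kernel M mk; exists c; split=> //.
have -> : \sum_i c i *: g i = \sum_i c i *: (g i - \sum_j M i j *: b j).
  under [RHS]eq_bigr do rewrite scalerBr scaler_sumr.
  rewrite sumrB [X in _ - X]exchange_big [X in _ - X]big1 ?subr0// => j _.
  by under eq_bigr do rewrite scalerA; rewrite -scaler_suml cM scale0r.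
by apply: subspace_sum => // i _; case: sI => _ _; apply.
Qed.

Lemma free_le_spans I m k (b : 'I_m -> V) (g : 'I_k -> V) : subspace I ->
  spans_mod I b -> free_mod I g -> (k <= m)%N.
Proof.
move=> sI sb fg; rewrite leqNgt; apply/negP => /(dependent_mod g sI sb)[c [[i ci0] Ic]].
by move: ci0; rewrite (fg c Ic) eqxx.
Qed.

(** The relation can be solved for [b i] modulo [I]. *)
Lemma spans_drop I k (b : 'I_k.+1 -> V) (c : 'I_k.+1 -> K) i : subspace I ->
  spans_mod I b -> I (\sum_j c j *: b j) -> c i != 0 ->
  spans_mod I (fun j => b (lift i j)).
Proof.
move=> sI sb Ic ci0 v; have [d Id] := sb v.
exists (fun j => d (lift i j) - d i / c i * c (lift i j)).
have -> : v - \sum_j (d (lift i j) - d i / c i * c (lift i j)) *: b (lift i j) =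
   (v - \sum_j d j *: b j) + (d i / c i) *: (\sum_j c j *: b j).
  rewrite -addrA; congr (_ + _).
  rewrite (bigD1_ord i)//= [X in _ + _ *: X](bigD1_ord i)//=.
  rewrite scalerDr scalerA divfK// opprD addrACA addNr add0r scaler_sumr.
  under eq_bigr do rewrite scalerBl.
  rewrite sumrB opprB addrC; congr (_ + _).
  by apply: eq_bigr => j _; rewrite scalerA.
by case: sI => _ ID IZ; apply: ID => //; exact: IZ.
Qed.

(** Otherwise a relation would allow one vector to be dropped. Minimality will come from the lower
    bound [N] on the codimension. *)
Lemma minimal_spans_free I k (b : 'I_k -> V) : subspace I -> spans_mod I b ->
  (forall m (g : 'I_m -> V), spans_mod I g -> (k <= m)%N) -> free_mod I b.
Proof.
move=> sI sb kmin c Ic i; apply/eqP/negP => /negP ci0.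
case: k => [|k] in b c i sb kmin Ic ci0 *; first by case: i ci0 => -[].
by have := kmin _ _ (spans_drop sI sb Ic ci0); rewrite ltnn.
Qed.

(** A free family of maximal length [k] spans: adjoining [v] breaks freeness, and in the resulting
    relation [v] has a nonzero coefficient because the family itself is free. *)
Lemma exists_basis_mod I m : subspace I ->
  (forall g : 'I_m.+1 -> V, exists c : 'I_m.+1 -> K,
     (exists i, c i != 0) /\ I (\sum_i c i *: g i)) ->
  exists k (b : 'I_k -> V), [/\ (k <= m)%N, free_mod I b & spans_mod I b].
Proof.
move=> sI dep; pose Q k := exists b : 'I_k -> V, free_mod I b.
have exk : exists k, `[< ~ Q k.+1 >].
  exists m; apply/asboolP => -[b fb]; have [c [[i ci0] Ic]] := dep b.
  by move: ci0; rewrite (fb c Ic) eqxx.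
case: (ex_minnP exk) => k /asboolP nQ kmin.
have km : (k <= m)%N.
  apply: kmin; apply/asboolP => -[b fb]; have [c [[i ci0] Ic]] := dep b.
  by move: ci0; rewrite (fb c Ic) eqxx.
have [b fb] : Q k.
  case: k kmin {nQ km} => [|k] kmin; first by exists (fun=> 0) => c _ [].
  by apply: contrapT => nQk; have := kmin k; rewrite ltnn => /(_ (asboolT nQk)).
exists k, b; split=> // v.
pose g (i : 'I_k.+1) := if unlift ord0 i is Some j then b j else v.
have /existsNP[c /not_implyP[Ic /existsNP[i0 ci0]]] : ~ free_mod I g.
  by move=> fg; apply: nQ; exists g.
move: Ic; rewrite big_ord_recl /g unlift_none.
under eq_bigr do rewrite liftK.
move=> Ic.
have c00 : c ord0 != 0.
  apply/eqP => c0; move: Ic; rewrite c0 scale0r add0r => /fb cb.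
  by apply: ci0; case: (unliftP ord0 i0) => [j ->|->//]; exact: cb.
exists (fun j => - ((c ord0)^-1 * c (lift ord0 j))).
have -> : v - \sum_j - ((c ord0)^-1 * c (lift ord0 j)) *: b j =
  (c ord0)^-1 *: (c ord0 *: v + \sum_j c (lift ord0 j) *: b j).
  rewrite scalerDr scalerA mulVf// scale1r -sumrN scaler_sumr; congr (_ + _).
  by apply: eq_bigr => j _; rewrite scaleNr opprK scalerA.
by case: sI => _ _; apply.
Qed.

End Codimension.

(** * Length of an ideal and bases of the quotient *)

Section IdealLength.
Variables (R : realType) (n : nat) (Omega : set 'rV[Cx R]_n).
Local Notation O := (holo Omega).
Implicit Types (I : set O).

(** All bases of the quotient have the same size, so the infimum is over a single value. *)
Lemma ideal_length_basis I k (b : 'I_k -> O) : subspace I ->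
  free_mod I b -> spans_mod I b -> ideal_length I = k%:R%:E.
Proof.
move=> sI fb sb; rewrite /ideal_length.
rewrite (_ : [set _ | _ in _] = [set k%:R%:E]) ?ereal_inf1//.
apply/seteqP; split=> [x [m [b' [fb' sb']] <-]|x ->]; last by exists k => //; exists b.
congr (_%:R%:E); apply/eqP; rewrite eqn_leq.
by rewrite (free_le_spans sI sb fb') (free_le_spans sI sb' fb).
Qed.

(** Without a finite basis the length is the infimum of the empty set, [+oo], which the bound
    excludes. *)
Lemma ideal_length_fin I (N : nat) : subspace I ->
  (ideal_length I <= N%:R%:E)%E ->
  exists k (b : 'I_k -> O), [/\ (k <= N)%N, free_mod I b, spans_mod I b &
    ideal_length I = k%:R%:E].
Proof.
move=> sI IN.
have [[k [b [fb sb]]]|none] := pselect (exists k (b : 'I_k -> O), quotient_basis I b).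
  have Ik := ideal_length_basis sI fb sb.
  by exists k, b; split=> //; move: IN; rewrite Ik lee_fin ler_nat.
move: IN; rewrite /ideal_length (_ : [set _ | _ in _] = set0) ?ereal_inf0//.
by apply/seteqP; split=> // x [k [b qb] _]; apply: none; exists k, b.
Qed.

End IdealLength.

(** * Locally uniform convergence *)

Section HolomorphicFunctions.
Variables (R : realType) (n : nat) (Omega : set 'rV[Cx R]_n).
Local Notation C := (Cx R).
Local Notation O := (holo Omega).
Implicit Types (f g : O) (z w : Omega).

Lemma holoD f g z : (f + g) z = f z + g z. Proof. by []. Qed.
Lemma holoM f g z : (f * g) z = f z * g z. Proof. by []. Qed.
Lemma holoZ c f z : (c *: f) z = c * f z. Proof. by []. Qed.
Lemma holoB f g z : (f - g) z = f z - g z. Proof. by []. Qed.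
Lemma holo_sum (J : Type) (r : seq J) (P : pred J) (F : J -> O) z :
  (\sum_(j <- r | P j) F j) z = \sum_(j <- r | P j) F j z.
Proof. by elim/big_rec2 : _ => // j x y _ <-. Qed.

Lemma holo_extension f : exists2 F : 'rV[C]_n -> C,
  (forall x, Omega x -> differentiable F x) & forall z, f z = F (val z).
Proof. by have /asboolP := holoP f. Qed.

Lemma holo_restriction (F : 'rV[C]_n -> C) :
  (forall x, Omega x -> differentiable F x) -> exists f : O, forall z, f z = F (val z).
Proof.
move=> dF; have hF : (fun z : Omega => F (val z)) \in @holomorphic R n Omega.
  by apply/asboolP; exists F.
by exists (Holo hF).
Qed.

Lemma in_Omega (x : 'rV[C]_n) : Omega x -> exists z : Omega, val z = x.
Proof. by move=> Ox; exists (exist _ x (mem_set Ox)). Qed.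

Lemma Omega_val z : Omega (val z).
Proof. exact: set_mem (valP z). Qed.

Lemma nbhs_sub z (W : set 'rV[C]_n) : nbhs (val z) W -> nbhs z (val @^-1` W).
Proof. exact: (@initial_continuous Omega 'rV[C]_n set_val z W). Qed.

Lemma sub_nbhs z (U : set Omega) : nbhs z U ->
  exists2 W : set 'rV[C]_n, nbhs (val z) W & forall w, W (val w) -> U w.
Proof.
move=> [V [[W oW WV] Vz] VU]; exists W.
  by apply: open_nbhs_nbhs; split=> //; move: Vz; rewrite -WV.
by move=> w Ww; apply: VU; rewrite -WV.
Qed.

Lemma cvg_locally_uniformlyP (T : Type) (F : set_system T) (f_ : T -> O) f : Filter F ->
  cvg_locally_uniformly F f_ f <->
  forall z, exists2 U : set Omega, nbhs z U & forall e : R, 0 < e ->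
    \forall t \near F, forall w, U w -> cabs (f w - f_ t w) < e.
Proof.
move=> FF; split=> fF z; have [U zU UP] := fF z; exists U => //.
  move=> e e0.
  have /UP : nbhs (f : {uniform` U -> C})
      [set h : {uniform` U -> C} | forall w, U w -> cabs (f w - h w) < e].
    apply/uniform_nbhs; exists [set xy | ball xy.1 (cpx e 0) xy.2]; split.
      by rewrite -entourage_ballE; exists (cpx e 0); rewrite /= -?cpx00 ?cpxr_lt.
    by move=> h /= H w /H; rewrite -ball_normE /= cabs_norm cpxr_lt.
  exact.
move=> P /uniform_nbhs[E [entE EP]].
move: entE; rewrite -entourage_ballE => -[e /cpos_cpx[d d0 ->] dE].
have := UP d d0; apply: filterS => t tP; apply: EP => w /tP wd; apply: dE => /=.
by rewrite -ball_normE /= cabs_norm cpxr_lt.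
Qed.

Lemma holo_continuous f z (e : R) : 0 < e -> exists2 U : set Omega, nbhs z U &
  forall w, U w -> cabs (f z - f w) < e.
Proof.
move=> e0; have [F dF fF] := holo_extension f.
have cF : {for val z, continuous F}.
  exact: differentiable_continuous (dF _ (Omega_val z)).
have /cF/nbhs_sub H : nbhs (F (val z)) [set y | cabs (F (val z) - y) < e].
  by apply/nbhs_cabsP; exists e => // y; rewrite cabs_distC.
by exists (val @^-1` (F @^-1` [set y | cabs (F (val z) - y) < e])) => // w; rewrite !fF.
Qed.

Lemma holo_locally_bounded f z : exists2 U : set Omega, nbhs z U &
  exists2 B : R, 0 < B & forall w, U w -> cabs (f w) <= B.
Proof.
have [U zU UP] := holo_continuous f z ltr01.
exists U => //; exists (cabs (f z) + 1); first by rewrite ltr_wpDl// cabs_ge0.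
move=> w /UP fw; rewrite -(subKr (f z) (f w)); apply: le_trans (cabsB _ _) _.
by rewrite lerD2l ltW.
Qed.

(** * Algebra of locally uniform limits *)

Section ConvergenceRules.
Variables (T : Type) (F : set_system T).
Hypothesis FF : Filter F.

Lemma clu_cst f : cvg_locally_uniformly F (fun=> f) f.
Proof.
apply/cvg_locally_uniformlyP => // z; exists setT; first exact: filterT.
by move=> e e0; apply: nearW => t w _; rewrite subrr cabs0.
Qed.

Lemma cluD (f_ g_ : T -> O) f g :
  cvg_locally_uniformly F f_ f -> cvg_locally_uniformly F g_ g ->
  cvg_locally_uniformly F (fun t => f_ t + g_ t) (f + g).
Proof.
move=> /(cvg_locally_uniformlyP _ _ FF) cf /(cvg_locally_uniformlyP _ _ FF) cg.
apply/cvg_locally_uniformlyP => // z.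
have [U zU UP] := cf z; have [V zV VP] := cg z.
exists (U `&` V) => [|e e0]; first exact: filterI.
have e20 : 0 < e / 2 by rewrite divr_gt0.
apply: filterS2 (UP _ e20) (VP _ e20) => t H1 H2 w [/H1 fw /H2 gw].
rewrite !holoD opprD addrACA; apply: le_lt_trans (cabsD _ _) _.
by rewrite (splitr e) ltrD.
Qed.

Lemma cluM (f_ : T -> O) f g : cvg_locally_uniformly F f_ f ->
  cvg_locally_uniformly F (fun t => g * f_ t) (g * f).
Proof.
move=> /(cvg_locally_uniformlyP _ _ FF) cf; apply/cvg_locally_uniformlyP => // z.
have [U zU UP] := cf z; have [V zV [B B0 VB]] := holo_locally_bounded g z.
exists (U `&` V) => [|e e0]; first exact: filterI.
apply: filterS (UP _ (divr_gt0 e0 B0)) => t H w [/H fw /VB gw].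
rewrite !holoM -mulrBr cabsM.
apply: (@le_lt_trans _ _ (B * cabs (f w - f_ t w))).
  by rewrite ler_wpM2r// cabs_ge0.
by rewrite mulrC -ltr_pdivlMr.
Qed.

(** Convergence of the finitely many coefficients is enough, each [g i] being locally bounded. *)
Lemma clu_comb m (c_ : T -> 'I_m -> C) (c : 'I_m -> C) (g : 'I_m -> O) :
  (forall i (e : R), 0 < e -> \forall t \near F, cabs (c i - c_ t i) < e) ->
  cvg_locally_uniformly F (fun t => \sum_i c_ t i *: g i) (\sum_i c i *: g i).
Proof.
elim: m c_ c g => [|m IH] c_ c g cc.
  by rewrite big_ord0; under eq_fun do rewrite big_ord0; exact: clu_cst.
rewrite big_ord_recl; under eq_fun do rewrite big_ord_recl.
apply: cluD; last by apply: (IH (fun t i => c_ t (lift ord0 i))) => i; exact: cc.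
apply/cvg_locally_uniformlyP => // z.
have [U zU [B B0 UB]] := holo_locally_bounded (g ord0) z; exists U => // e e0.
apply: filterS (cc ord0 _ (divr_gt0 e0 B0)) => t H w /UB gw.
rewrite !holoZ -mulrBl cabsM; move: H; rewrite ltr_pdivlMr//; apply: le_lt_trans.
by rewrite ler_wpM2l// cabs_ge0.
Qed.

End ConvergenceRules.

Lemma clu_comp (T T' : Type) (F : set_system T) (F' : set_system T') (phi : T' -> T)
    (f_ : T -> O) f : Filter F -> Filter F' -> phi @ F' --> F ->
  cvg_locally_uniformly F f_ f -> cvg_locally_uniformly F' (f_ \o phi) f.
Proof.
move=> FF FF' phiF /(cvg_locally_uniformlyP _ _ FF) cf; apply/cvg_locally_uniformlyP => // z.
by have [U zU UP] := cf z; exists U => // e /UP; exact: phiF.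
Qed.

Lemma is_ideal_subspace (I : set O) : is_ideal I -> subspace I.
Proof.
move=> [I0 ID IM]; split=> // c v Iv.
have [k kE] := @holo_restriction (cst c) (fun x _ => @differentiable_cst _ _ _ c x).
rewrite (_ : c *: v = k * v); first exact: IM.
by apply: val_inj; apply/funext => z; rewrite /= -[RHS]/(k z * v z) kE.
Qed.

Lemma vanishing_is_ideal (S : set 'rV[C]_n) : is_ideal (vanishing_ideal Omega S).
Proof.
split=> [z _|f g If Ig z Sz|g f If z Sz] //; first by rewrite holoD If// Ig// addr0.
by rewrite holoM If// mulr0.
Qed.

End HolomorphicFunctions.

(** * Ideals of points *)

Section PointIdeals.
Variables (R : realType) (n : nat) (Omega : set 'rV[Cx R]_n).
Local Notation C := (Cx R).
Local Notation V := 'rV[C]_n.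
Local Notation O := (holo Omega).

Lemma nbhs_polydisc (r : R) : 0 < r -> nbhs (0 : V) (polydisc r).
Proof.
move=> r0; apply/nbhs_ballP; exists (cpx r 0); first by rewrite /= -cpx00 cpxr_lt.
move=> z [_ zr] i; have := zr 0 i.
by rewrite -ball_normE /= mxE sub0r cabs_norm cabsN cpxr_lt.
Qed.

Lemma polydisc_in_nbhs (W : set V) : nbhs (0 : V) W ->
  exists2 r : R, 0 < r & polydisc r `<=` W.
Proof.
move=> /nbhs_ballP[e /cpos_cpx[r r0 ->] rW]; exists r => // z zr; apply: rW.
split=> [|i j]; first by rewrite -cpx00 cpxr_lt.
by rewrite (ord1 i) -ball_normE /= mxE sub0r cabs_norm cabsN cpxr_lt.
Qed.

Lemma compact_cpolydisc (r : R) : compact (cpolydisc (n := n) r).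
Proof.
by have := @rV_compact C n (fun=> [set z : C | cabs z <= r]) (fun=> compact_cdisk (r := r)).
Qed.

Lemma sepholo_differentiable (r : R) (F : V -> C) :
  (forall z, polydisc r z -> differentiable F z) -> sepholo r F.
Proof.
move=> dF z i /dF dz; apply/cdiffP.
have E : (fun h : C => h^-1 *: (((fun t => F (upd z i t)) \o shift (z 0 i)) (h *: 1) -
     F (upd z i (z 0 i)))) =
   (fun h : C => h^-1 *: ((F \o shift z) (h *: delta_mx 0 i) - F z)).
  apply/funext => h /=; rewrite upd_id; congr (_ *: (F _ - _)); apply/rowP => j.
  rewrite !mxE; have [->|_] := eqVneq j i; last by rewrite mulr0 add0r.
  by rewrite -[h *: 1]/(h * 1).
by rewrite /derivable E; exact: diff_derivable.
Qed.

(** A product of affine functions, one for each [m], in a coordinate where [p m] and [p l]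
    differ. *)
Lemma separating_function (I : eqType) (p : I -> V) (l : I) (s : seq I) :
  (forall m, m \in s -> p m != p l) ->
  exists F : V -> C, [/\ forall z, differentiable F z, F (p l) = 1 &
    forall m, m \in s -> F (p m) = 0].
Proof.
elim: s => [_|m s IH ps].
  by exists (cst 1); split=> // z; exact: differentiable_cst.
have [|F [dF Fl Fs]] := IH; first by move=> m' ms; apply: ps; rewrite inE ms orbT.
have /rV0Pn[k] : p l - p m != 0 by rewrite subr_eq0 eq_sym ps// mem_head.
rewrite !mxE => dk0.
pose G : V -> C := cst (p l 0 k - p m 0 k)^-1 * ((fun z : V => z 0 k) - cst (p m 0 k)).
have GE z : (G * F) z = (p l 0 k - p m 0 k)^-1 * (z 0 k - p m 0 k) * F z by [].
exists (G * F); split=> [z||m'].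
- apply: differentiableM; last exact: dF.
  apply: differentiableM; first exact: differentiable_cst.
  by apply: differentiableB; [exact: differentiable_coord|exact: differentiable_cst].
- by rewrite GE Fl mulVf// mulr1.
- rewrite inE => /predU1P[->|ms]; first by rewrite GE subrr mulr0 mul0r.
  by rewrite GE Fs// mulr0.
Qed.

Lemma lagrange_functions (N : nat) (p : 'I_N -> V) : injective p ->
  exists F : 'I_N -> V -> C, (forall l z, differentiable (F l) z) /\
    forall l m, F l (p m) = (m == l)%:R.
Proof.
move=> pI; have /choice[F FP] (l : 'I_N) : exists F : V -> C,
    (forall z, differentiable F z) /\ forall m, F (p m) = (m == l)%:R.
  have [m|F [dF Fl F0]] := @separating_function _ p l (enum [pred m | m != l]).
    by rewrite mem_enum inE; apply: contra_neq => /pI.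
  exists F; split=> // m.
  by have [->//|ml] := eqVneq m l; rewrite F0// mem_enum inE.
by exists F; split=> l; have [] := FP l.
Qed.

Lemma vanishing_ideal_basis (N : nat) (p : 'I_N -> V) : injective p ->
  (forall l, Omega (p l)) -> exists b : 'I_N -> O,
    free_mod (vanishing_ideal Omega (range p)) b /\
    spans_mod (vanishing_ideal Omega (range p)) b.
Proof.
move=> pI pO; have [F [dF FE]] := lagrange_functions pI.
have /choice[b bE] l : exists f : O, forall z, f z = F l (val z).
  by apply: holo_restriction => x _; exact: dF.
have /choice[q qE] l := in_Omega (pO l).
have sumE (c : 'I_N -> C) z l : val z = p l -> (\sum_i c i *: b i) z = c l.
  move=> zl; rewrite holo_sum (bigD1 l)//= -[X in X + _]/(c l * b l z) bE zl FE eqxx mulr1.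
  rewrite big1 ?addr0// => m ml.
  by rewrite -[LHS]/(c m * b m z) bE zl FE eq_sym (negbTE ml) mulr0.
exists b; split=> [c Ic l|f].
  have /Ic : range p (val (q l)) by rewrite qE; exists l.
  by rewrite (sumE _ _ l).
exists (fun l => f (q l)) => z [l _ lz].
rewrite holoB (sumE _ _ l)//; apply/eqP; rewrite subr_eq0; apply/eqP; congr (holo_fun f _).
by apply: val_inj; rewrite qE.
Qed.

(** The liminf along one sequence. It contains the liminf over [A] and also the limits along that
    sequence which generate the limsup. *)
Definition seq_liminf (N : nat) (p : nat -> 'I_N -> V) : set O :=
  [set f | exists2 f_ : nat -> O,
    forall j, vanishing_ideal Omega (range (p j)) (f_ j) & cvg_locally_uniformly \oo f_ f].

Lemma seq_liminf_subspace (N : nat) (p : nat -> 'I_N -> V) : subspace (seq_liminf p).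
Proof.
apply: is_ideal_subspace; split=> [|f g [f_ If cf] [g_ Ig cg]|g f [f_ If cf]].
- by exists (fun=> 0); [move=> j; have [] := vanishing_is_ideal Omega (range (p j))|exact: clu_cst].
- exists (fun j => f_ j + g_ j); last exact: cluD.
  by move=> j; have [_ ID _] := vanishing_is_ideal Omega (range (p j)); exact: ID.
- exists (fun j => g * f_ j); last exact: cluM.
  by move=> j; have [_ _ IM] := vanishing_is_ideal Omega (range (p j)); exact: IM.
Qed.

(* If [N > k], some nonzero combination [sum_l lam_l * delta_(p_l)] of point evaluations
   kills every [b i].  Its values [y] on the monomials then satisfy [y = E y] with [E] small,
   hence vanish, and so it kills everything: absurd. *)
Lemma seq_liminf_codim (N k : nat) (p : nat -> 'I_N -> V) (b : 'I_k -> O) :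
  open Omega -> Omega 0 -> (forall j l, Omega (p j l)) ->
  (forall j, injective (p j)) -> (forall l, p j l @[j --> \oo] --> (0 : V)) ->
  spans_mod (seq_liminf p) b -> (N <= k)%N.
Proof.
move=> oO O0 pO pI p0 sb; rewrite leqNgt; apply/negP => kN.
have [J [mon [dmon interp]]] := bounded_interpolation R n N.
have /choice[mu muE] (j : J) : exists f : O, forall z, f z = mon j (val z).
  by apply: holo_restriction => x _; exact: dmon.
have /choice[c cP] (j : J) := sb (mu j).
have [x0 x0E] := in_Omega O0.
have [h hE] : exists h : J -> O, forall j, h j = mu j - \sum_i c j i *: b i.
  by exists (fun j => mu j - \sum_i c j i *: b i).
have /choice[h_ h_P] (j : J) : exists f_ : nat -> O,
    (forall t, vanishing_ideal Omega (range (p t)) (f_ t)) /\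
    exists2 W : set V, nbhs (0 : V) W & forall e : R, 0 < e ->
      \forall t \near \oo, forall w : Omega, W (val w) -> cabs (h j w - f_ t w) < e.
  have := cP j; rewrite -hE => -[f_ f_v /cvg_locally_uniformlyP cf].
  exists f_; split=> //; have [U xU UP] := cf x0.
  have [W xW WU] := sub_nbhs xU; exists W; first by rewrite -x0E.
  by move=> e /UP; apply: filterS => t H w /WU; exact: H.
have /choice[W WP] (j : J) : exists Wj : set V, nbhs (0 : V) Wj /\ forall e : R, 0 < e ->
    \forall t \near \oo, forall w : Omega, Wj (val w) -> cabs (h j w - h_ j t w) < e.
  by have [_ [W xW WP]] := h_P j; exists W.
have [rho rho0 rhoP] : exists2 r : R, 0 < r & polydisc r `<=`
    Omega `&` [set z | forall j, W j z].
  apply: polydisc_in_nbhs; apply: filterI; first exact: open_nbhs_nbhs.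
  by apply: (@filter_forall _ _ W (nbhs (0 : V))) => j; exact: (WP j).1.
pose r := rho / 2; have r0 : 0 < r by rewrite divr_gt0.
have rrho : r < rho by rewrite /r; lra.
have c_in z : cpolydisc r z -> polydisc rho z.
  by move=> zr i; exact: le_lt_trans (zr i) rrho.
have [K K0 {}interp] := interp r r0.
(* Chosen so that [K e #|J| <= 1 / 2], which makes the matrix [E] a contraction. *)
pose e := (K * #|J|%:R + 1)^-1 / 2.
have KJ0 : 0 <= K * #|J|%:R by rewrite mulr_ge0.
have e0 : 0 < e by rewrite divr_gt0// invr_gt0; lra.
have near_p : \forall t \near \oo, forall l, polydisc (r / 2) (p t l).
  by apply: filter_forall => l; apply: (p0 l); apply: nbhs_polydisc; rewrite divr_gt0.
have near_h : \forall t \near \oo, forall j (w : Omega),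
    W j (val w) -> cabs (h j w - h_ j t w) < e.
  by apply: filter_forall => j; exact: (WP j).2.
have [t [pr hr]] := filter_ex (filterI near_p near_h).
have pr' l : cpolydisc (r / 2) (p t l) by move=> i; exact: ltW (pr l i).
have /choice[q qE] l := in_Omega (pO t l).
have sep (F : V -> C) : (forall z, Omega z -> differentiable F z) -> sepholo rho F.
  by move=> dF; apply: sepholo_differentiable => z /rhoP[/dF].
(* [h_ j t] vanishes at the points, so [h j] agrees there with [h j - h_ j t], which is below [e] on
   the polydisc; interpolating this difference gives small coefficients. *)
have /choice[E EP] (j : J) : exists tau : J -> C, (forall i, cabs (tau i) <= K * e) /\
    forall l, h j (q l) = \sum_i tau i * mon i (p t l).
  have [G dG GE] := holo_extension (h j - h_ j t).
  have [|tau [tauK tauE]] := interp rho (p t) G e rrho pr' (sep G dG).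
    move=> z /c_in/rhoP[Oz Wz]; have [w wz] := in_Omega Oz.
    by rewrite -wz -GE; apply/ltW/hr; rewrite wz.
  exists tau; split=> // l; rewrite -tauE -qE -GE holoB.
  by rewrite (h_P j).1 ?subr0//; exists l.
have [lam [[l lam0] lamP]] := wide_kernel (fun l i => b i (q l)) kN.
pose y j := \sum_l lam l * mon j (p t l).
have yE j : y j = \sum_i E j i * y i.
  transitivity (\sum_l lam l * (h j (q l) + \sum_i c j i * b i (q l))).
    apply: eq_bigr => m _; congr (_ * _).
    rewrite -qE -muE -[LHS](subrK ((\sum_i c j i *: b i) (q m))) -holoB -hE; congr (_ + _).
    by rewrite holo_sum; apply: eq_bigr => i _; rewrite holoZ.
  under eq_bigr do rewrite mulrDr.
  rewrite big_split /= [X in _ + X](_ : _ = 0) ?addr0.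
    under eq_bigr do rewrite (EP j).2 mulr_sumr.
    rewrite exchange_big; apply: eq_bigr => i _; rewrite mulr_sumr.
    by apply: eq_bigr => m _; rewrite mulrCA.
  under eq_bigr do rewrite mulr_sumr.
  rewrite exchange_big big1// => i _.
  under eq_bigr do rewrite mulrCA.
  by rewrite -mulr_sumr lamP mulr0.
have y0 j : y j = 0.
  pose s := \sum_j cabs (y j).
  have s0 : 0 <= s by apply: sumr_ge0 => *; exact: cabs_ge0.
  have sle : s <= (K * e * s) *+ #|J|.
    rewrite -sumr_const; apply: ler_sum => i _; rewrite yE.
    apply: le_trans (cabs_sum _ _ _) _; rewrite mulr_sumr; apply: ler_sum => m _.
    by rewrite cabsM ler_wpM2r ?cabs_ge0// (EP i).1.
  have : s <= 0.
    have K1 : K * e * #|J|%:R <= 1 / 2.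
      rewrite mulrAC /e mulrA ler_pM2r ?invr_gt0//.
      by rewrite ler_pdivrMr; lra.
    move: sle; rewrite -[leRHS]mulr_natr; have : 0 <= s * (1 / 2 - K * e * #|J|%:R).
      by rewrite mulr_ge0// subr_ge0.
    by lra.
  rewrite le_eqVlt ltNge s0 orbF psumr_eq0 => [/allP/(_ j)|*]; last exact: cabs_ge0.
  by rewrite mem_index_enum cabs_eq0 => /(_ isT)/eqP.
(* The combination [lam] now kills every monomial, hence every function interpolated by monomials.
   Applied to the Lagrange function of [l], it gives [lam l = 0]. *)
have [L [dL LE]] := lagrange_functions (pI t).
have [||z0 _ Lmax] := @compact_EVT_max _ R (fun z => cabs (L l z)) _ _ (@compact_cpolydisc r).
- by exists 0 => i; rewrite mxE cabs0 ltW.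
- apply: continuous_in_subspaceT => z _.
  apply: (@continuous_comp _ _ _ (L l) (@cabs R : C -> R)); last exact: continuous_cabs.
  exact: differentiable_continuous.
have [z zr|tau [_ tauE]] :=
    interp rho (p t) (L l) (cabs (L l z0)) rrho pr' (sep _ (fun z _ => dL l z)).
  by apply: Lmax; rewrite inE.
move: lam0; rewrite (_ : lam l = 0) ?eqxx//.
transitivity (\sum_m lam m * L l (p t m)).
  rewrite (bigD1 l)//= big1 ?LE ?eqxx ?mulr1 ?addr0// => m ml.
  by rewrite LE (negbTE ml) mulr0.
under eq_bigr do rewrite tauE mulr_sumr.
rewrite exchange_big big1// => j _.
under eq_bigr do rewrite mulrCA.
by rewrite -mulr_sumr -/(y j) y0 mulr0.
Qed.

End PointIdeals.

(** * Limits of ideals *)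

Section Sequences.
Variable R : realType.
Local Notation C := (Cx R).

Lemma cvg_to0P (T : Type) (F : set_system T) (e : T -> C) : Filter F ->
  e @ F --> (0 : C) <-> forall d : R, 0 < d -> \forall t \near F, cabs (e t) < d.
Proof.
move=> FF; split=> [e0 d d0|H U /nbhs_cabsP[d d0 dU]].
  apply: (e0 [set z : C | cabs z < d]).
  by apply/nbhs_cabsP; exists d => // z; rewrite subr0.
by apply: filterS (H d d0) => t td; apply: dU; rewrite subr0.
Qed.

Lemma near_inv_lt (d : R) : 0 < d -> \forall k \near \oo, (k.+1%:R)^-1 < d.
Proof. by move=> d0; exact: (near_infty_natSinv_lt (PosNum d0)). Qed.

(** Compactness of the closed polydisc; [k <= phi k] lets limits at infinity pass to the extracted
    sequence. *)
Lemma cluster_sequence (m : nat) (c : nat -> 'I_m -> C) :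
  (forall j i, cabs (c j i) <= 1) ->
  exists (c' : 'I_m -> C) (phi : nat -> nat), (forall k, (k <= phi k)%N) /\
    forall i (e : R), 0 < e -> \forall k \near \oo, cabs (c' i - c (phi k) i) < e.
Proof.
move=> c1.
have := @rV_compact C m (fun=> [set z : C | cabs z <= 1]) (fun=> compact_cdisk (r := 1)).
move=> /(_ ((fun j => \row_i c j i) @ \oo) _)[|v [_ vcl]].
  by exists 0%N => // j _ i; rewrite mxE; exact: c1.
have /choice[phi phiP] (k : nat) : exists j, (k <= j)%N /\
    forall i, cabs (v 0 i - c j i) < k.+1%:R^-1.
  have [] := vcl [set w | exists2 j, (k <= j)%N & w = \row_i c j i]
    [set w : 'rV[C]_m | forall i, cabs (v 0 i - w 0 i) < k.+1%:R^-1].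
  - by exists k => // j kj; exists j.
  - apply/nbhs_ballP; exists (cpx k.+1%:R^-1 0).
      by rewrite /= -cpx00 cpxr_lt invr_gt0.
    move=> w [_ vw] i; have := vw 0 i.
    by rewrite -ball_normE /= cabs_norm cpxr_lt.
  - move=> _ [[j kj ->] H]; exists j; split=> // i.
    by have := H i; rewrite mxE.
exists (v 0), phi; split=> [k|i e e0]; first by have [] := phiP k.
apply: filterS (near_inv_lt e0) => k; apply: lt_trans.
by have [_] := phiP k; apply.
Qed.

End Sequences.

(** * Liminf and limsup of a family of ideals *)

Section LimitIdeals.
Variables (R : realType) (n : nat) (Omega : set 'rV[Cx R]_n).
Local Notation C := (Cx R).
Local Notation O := (holo Omega).
Variables (A : set C) (Is : C -> set O).
Hypothesis idealIs : forall e, is_ideal (Is e).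

Lemma near_withinP (P : set C) :
  (\forall e \near within A (nbhs (0 : C)), P e) <->
  exists2 d : R, 0 < d & forall e, cabs e < d -> A e -> P e.
Proof.
split=> [/nbhs_cabsP[d d0 dP]|[d d0 dP]].
  by exists d => // e ed; apply: dP; rewrite subr0.
by apply/nbhs_cabsP; exists d => // e; rewrite subr0; exact: dP.
Qed.

Lemma closure_sequence : closure A (0 : C) -> exists e : nat -> C,
  (forall j, A (e j)) /\ forall j, cabs (e j) < j.+1%:R^-1.
Proof.
move=> A0; have /choice[e eP] (j : nat) : exists e, A e /\ cabs e < j.+1%:R^-1.
  have [|e [Ae ej]] := A0 [set e : C | cabs e < j.+1%:R^-1]; last by exists e.
  by apply/nbhs_cabsP; exists j.+1%:R^-1 => [|z]; rewrite ?invr_gt0// subr0.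
by exists e; split=> j; have [] := eP j.
Qed.

Lemma small_sequence_cvg0 (e : nat -> C) :
  (forall j, cabs (e j) < j.+1%:R^-1) -> e j @[j --> \oo] --> (0 : C).
Proof.
move=> ej; apply/cvg_to0P => d d0; apply: filterS (near_inv_lt d0) => j.
exact: lt_trans.
Qed.

Lemma liminf_is_ideal : is_ideal (ideal_liminf A Is).
Proof.
split=> [|f g [f_ If cf] [g_ Ig cg]|g f [f_ If cf]].
- by exists (fun=> 0); [move=> e _; have [] := idealIs e|exact: clu_cst].
- exists (fun e => f_ e + g_ e); last exact: cluD.
  by move=> e Ae; have [_ ID _] := idealIs e; apply: ID; [exact: If|exact: Ig].
- exists (fun e => g * f_ e); last exact: cluM.
  by move=> e Ae; have [_ _ IM] := idealIs e; apply: IM; exact: If.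
Qed.

Lemma limsup_is_ideal : is_ideal (ideal_limsup A Is).
Proof.
split=> [J [[J0 _ _] _]|f g If Ig J|g f If J] //.
- by move=> [iJ EJ]; have [_ JD _] := iJ; apply: JD; [exact: If|exact: Ig].
- by move=> [iJ EJ]; have [_ _ JM] := iJ; apply: JM; exact: If.
Qed.

Lemma cvg_within_sequence (e : nat -> C) : (forall j, A (e j)) ->
  e j @[j --> \oo] --> (0 : C) -> e j @[j --> \oo] --> within A (nbhs (0 : C)).
Proof.
move=> Ae e0 P AP; have H : \forall j \near \oo, A (e j) -> P (e j).
  exact: (e0 (fun x => A x -> P x) AP).
by rewrite /= /nbhs /=; apply: filterS H => j; apply; exact: Ae.
Qed.

Lemma liminf_along (e : nat -> C) f : (forall j, A (e j)) ->
  e j @[j --> \oo] --> (0 : C) -> ideal_liminf A Is f ->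
  exists2 f_ : nat -> O, forall j, Is (e j) (f_ j) & cvg_locally_uniformly \oo f_ f.
Proof.
move=> Ae e0 [f_ If cf]; exists (f_ \o e) => [j|]; first exact: If.
exact: clu_comp (cvg_within_sequence Ae e0) cf.
Qed.

Lemma liminf_sub_limsup : closure A (0 : C) -> ideal_liminf A Is `<=` ideal_limsup A Is.
Proof.
move=> /closure_sequence[e [Ae ej]] f Lf J [_]; apply.
have [f_ If cf] := liminf_along Ae (small_sequence_cvg0 ej) Lf.
by exists e, f_; split=> //; exact: small_sequence_cvg0.
Qed.

(** After extraction the coefficients converge, so the combinations converge locally uniformly and
    their limit is a generator of the limsup. *)
Lemma limsup_cluster m (g : 'I_m -> O) (e : nat -> C) (c : nat -> 'I_m -> C) :
  (forall j, A (e j)) -> e j @[j --> \oo] --> (0 : C) ->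
  (forall j i, cabs (c j i) <= 1) -> (forall j, Is (e j) (\sum_i c j i *: g i)) ->
  exists (c' : 'I_m -> C) (phi : nat -> nat), ideal_limsup A Is (\sum_i c' i *: g i) /\
    forall i (d : R), 0 < d -> \forall k \near \oo, cabs (c' i - c (phi k) i) < d.
Proof.
move=> Ae e0 c1 Ic; have [c' [phi [phik cphi]]] := cluster_sequence c1.
exists c', phi; split=> // J [_]; apply.
exists (e \o phi), (fun k => \sum_i c (phi k) i *: g i); split=> [j||j|]; first exact: Ae.
- apply: cvg_comp e0 => P [K _ KP]; exists K => // k Kk; apply: KP => /=.
  exact: leq_trans Kk (phik k).
- exact: Ic.
- exact: clu_comb.
Qed.

Definition dependent_in m (I : set O) := forall g : 'I_m -> O, exists c : 'I_m -> C,
  (exists i, c i != 0) /\ I (\sum_i c i *: g i).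

(** The normalization keeps the relation from degenerating to 0 in the limit. *)
Lemma dependent_normalized m (I : set O) (g : 'I_m -> O) : subspace I ->
  dependent_in m I -> exists c : 'I_m -> C,
    \sum_i cabs (c i) = 1 /\ I (\sum_i c i *: g i).
Proof.
move=> [_ _ IZ] /(_ g)[c [[i ci0] Ic]]; pose s := \sum_i cabs (c i).
have s0 : 0 < s.
  rewrite /s (bigD1 i)//= ltr_pwDl ?cabs_gt0//.
  by apply: sumr_ge0 => *; exact: cabs_ge0.
exists (fun i => cpx s^-1 0 * c i); split.
  under eq_bigr do rewrite cabsM cabs_cpxr ger0_norm ?invr_ge0 ?ltW//.
  by rewrite -mulr_sumr mulVf// gt_eqF.
by under eq_bigr do rewrite -scalerA; rewrite -scaler_sumr; exact: IZ.
Qed.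

Lemma cabs_le_sum m (c : 'I_m -> C) i : cabs (c i) <= \sum_j cabs (c j).
Proof. by rewrite (bigD1 i)//= lerDl sumr_ge0// => *; exact: cabs_ge0. Qed.

Lemma limsup_dependent m : closure A (0 : C) ->
  (forall e, A e -> dependent_in m (Is e)) -> dependent_in m (ideal_limsup A Is).
Proof.
move=> /closure_sequence[e [Ae ej]] dep g.
have /choice[c cP] j := dependent_normalized g (is_ideal_subspace (idealIs (e j)))
  (dep _ (Ae j)).
have c1 j i : cabs (c j i) <= 1.
  by have [<- _] := cP j; exact: cabs_le_sum.
have [c' [phi [Ic' cphi]]] := limsup_cluster Ae (small_sequence_cvg0 ej) c1
  (fun j => (cP j).2).
exists c'; split=> //; apply: contrapT => /forallNP c'0.
(* If [c'] were 0, all [m] coefficients would eventually be below [1 / (m + 1)], too small for a sum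
   equal to 1. *)
have near_small : \forall k \near \oo, forall i, cabs (c' i - c (phi k) i) < m.+1%:R^-1.
  by apply: filter_forall => i; apply: cphi; rewrite invr_gt0.
have [k kP] := filter_ex near_small.
have : \sum_i cabs (c (phi k) i) <= \sum_(i < m) (m.+1%:R^-1 : R).
  apply: ler_sum => i _; rewrite -cabsN -[- _]add0r.
  by have /negP/negPn/eqP <- := c'0 i; exact: ltW.
rewrite (cP (phi k)).1 sumr_const card_ord -[leRHS]mulr_natr leNgt => /negP; apply.
by rewrite mulrC ltr_pdivrMr// mul1r ltr_nat.
Qed.

Lemma limsup_sub_liminf m (b : 'I_m -> O) : free_mod (ideal_limsup A Is) b ->
  (forall e, A e -> dependent_in m.+1 (Is e)) -> ideal_limsup A Is `<=` ideal_liminf A Is.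
Proof.
move=> fb dep f Lf.
pose g (i : 'I_m.+1) := if unlift ord0 i is Some j then b j else f.
have gE (c : 'I_m.+1 -> C) :
    \sum_i c i *: g i = c ord0 *: f + \sum_j c (lift ord0 j) *: b j.
  rewrite big_ord_recl /g unlift_none; congr (_ + _).
  by apply: eq_bigr => j _; rewrite liftK.
have /choice[c cP] e : exists c : 'I_m.+1 -> C, A e ->
    \sum_i cabs (c i) = 1 /\ Is e (\sum_i c i *: g i).
  have [Ae|nAe] := pselect (A e); last by exists (fun=> 0).
  have [c cP] := dependent_normalized g (is_ideal_subspace (idealIs e)) (dep e Ae).
  by exists c.
(* Otherwise the coefficient stays at least [d] along a sequence tending to 0. A cluster point gives
   a relation modulo the limsup; as [f] lies in it, only the [b j] remain, and their freeness
   contradicts [d > 0]. *)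
have small i (d : R) : 0 < d ->
    \forall e \near within A (nbhs (0 : C)), cabs (c e (lift ord0 i)) < d.
  move=> d0; apply: contrapT => nsmall.
  have /choice[e eP] (j : nat) : exists e, [/\ A e, cabs e < j.+1%:R^-1 &
      d <= cabs (c e (lift ord0 i))].
    apply: contrapT => /forallNP noe; apply: nsmall; apply/near_withinP.
    exists j.+1%:R^-1; first by rewrite invr_gt0.
    by move=> e ej Ae; rewrite ltNge; apply/negP => de; exact: (noe e).
  have Ae j : A (e j) by have [] := eP j.
  have ej j : cabs (e j) < j.+1%:R^-1 by have [] := eP j.
  have c1 j i' : cabs (c (e j) i') <= 1.
    by have [<- _] := cP _ (Ae j); exact: cabs_le_sum.
  have [c' [phi [Ic' cphi]]] := limsup_cluster Ae (small_sequence_cvg0 ej) c1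
    (fun j => (cP _ (Ae j)).2).
  have sI := is_ideal_subspace limsup_is_ideal.
  have c'0 : c' (lift ord0 i) = 0.
    apply: (fb (fun j => c' (lift ord0 j))).
    move: Ic'; rewrite gE => Ic'.
    have cf : ideal_limsup A Is (c' ord0 *: f) by case: sI => _ _; apply.
    by have := subspaceB sI Ic' cf; rewrite [_ *: f + _]addrC addrK.
  have [k kP] := filter_ex (cphi (lift ord0 i) d d0).
  by move: kP; rewrite c'0 sub0r cabsN ltNge; have [_ _ ->] := eP (phi k).
pose c2 e (i : 'I_m.+1) := (c e ord0)^-1 * c e i.
pose good e := A e /\ c e ord0 != 0.
(* Near 0 the other [m] coefficients sum to at most 1/2, which leaves at least 1/2 for the
   coefficient of [f]. *)
have c0_ge : \forall e \near within A (nbhs (0 : C)), 2^-1 <= cabs (c e ord0).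
  have H : \forall e \near within A (nbhs (0 : C)), forall i,
      cabs (c e (lift ord0 i)) < (2 * m.+1%:R)^-1.
    apply: (@filter_forall _ _ (fun i => [set e | cabs (c e (lift ord0 i)) <
      (2 * m.+1%:R)^-1]) (within A (nbhs (0 : C)))) => i.
    exact: small.
  have /near_withinP[d d0 dP] := H.
  apply/near_withinP; exists d => // e ed Ae.
  have [s1 _] := cP e Ae; move: s1; rewrite big_ord_recl => s1.
  have : \sum_(i < m) cabs (c e (lift ord0 i)) <= \sum_(i < m) (2 * m.+1%:R : R)^-1.
    by apply: ler_sum => i _; apply/ltW/dP.
  rewrite sumr_const card_ord -[leRHS]mulr_natr => s2.
  suff /(le_trans s2) : (2 * m.+1%:R)^-1 * m%:R <= (2^-1 : R).
    by move: s1; set t := \sum_(_ < _) _; lra.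
  rewrite invfM -mulrA ger_pMr ?invr_gt0// mulrC ler_pdivrMr// mul1r.
  by rewrite ler_nat.
(* Away from 0 the coefficient of [f] may vanish; the value there is 0, which lies in every
   ideal. *)
exists (fun e => \sum_i (if `[< good e >] then c2 e i else 0) *: g i).
  move=> e Ae; have sI := is_ideal_subspace (idealIs e); case: asboolP => _.
    under eq_bigr do rewrite -scalerA; rewrite -scaler_sumr.
    by case: sI => _ _; apply; have [] := cP e Ae.
  by under eq_bigr do rewrite scale0r; rewrite big1//; case: sI.
rewrite (_ : f = \sum_i (if i == ord0 then 1 else 0) *: g i); last first.
  by rewrite gE eqxx scale1r big1 ?addr0// => j _; rewrite scale0r.
apply: clu_comb => i d d0.
have [i0|i0] := unliftP ord0 i; last first.
  have /near_withinP[d1 d10 d1P] := c0_ge.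
  apply/near_withinP; exists d1 => // e ed Ae.
  have c0 : c e ord0 != 0 by rewrite -cabs_gt0; have := d1P e ed Ae; lra.
  by rewrite i0 eqxx asboolT// /c2 mulVf// subrr cabs0.
(* Dividing by a coefficient of modulus at least 1/2 at most doubles, hence [d / 2]. *)
move=> iE; have d20 : 0 < d / 2 by rewrite divr_gt0.
have /near_withinP[d1 d10 d1P] := c0_ge.
have /near_withinP[d2 d20' d2P] := small i0 _ d20.
apply/near_withinP; exists (Num.min d1 d2); first by rewrite lt_min d10.
move=> e; rewrite lt_min => /andP[ed1 ed2] Ae.
have ce := d1P e ed1 Ae; have c0 : c e ord0 != 0 by rewrite -cabs_gt0; lra.
rewrite asboolT// iE /c2 /= sub0r cabsN cabsM cabsV mulrC ltr_pdivrMr ?cabs_gt0//.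
by have := d2P e ed2 Ae; nra.
Qed.

End LimitIdeals.

(** * Convergence of the ideals of colliding points *)

Theorem theorem2p5 (R : realType) (n : nat) (Omega : set 'rV[Cx R]_n)
    (A : set (Cx R)) (N : nat) (a : Cx R -> 'I_N -> 'rV[Cx R]_n) :
  bounded_hyperconvex_domain Omega ->
  Omega 0 ->
  closure A 0 -> ~ A 0 ->
  (forall e, A e -> forall i, Omega (a e i)) ->
  (forall e, A e -> injective (a e)) ->
  (forall i, a e i @[e --> within A (nbhs (0 : Cx R))] --> (0 : 'rV[Cx R]_n)) ->
  let Is := fun e => vanishing_ideal Omega (range (a e)) in
  [/\ forall e, A e -> ideal_length (Is e) = N%:R%:E,
      let I := ideal_limsup A Is in
        ((N%:R%:E <= ideal_length I)%E <-> ideal_length I = N%:R%:E) /\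
        ((N%:R%:E <= ideal_length I)%E -> ideal_cvg_to A Is I)
    & let I := ideal_liminf A Is in
        ((ideal_length I <= N%:R%:E)%E <-> ideal_length I = N%:R%:E) /\
        ((ideal_length I <= N%:R%:E)%E -> ideal_cvg_to A Is I)].
Proof.
move=> [_ oO _ _ _] O0 clA _ aO aI a0 Is.
have idealIs e : is_ideal (Is e) by exact: vanishing_is_ideal.
have basis e : A e -> exists b : 'I_N -> holo Omega, free_mod (Is e) b /\ spans_mod (Is e) b.
  by move=> Ae; apply: vanishing_ideal_basis; [exact: aI|exact: aO].
have dep e : A e -> dependent_in N.+1 (Is e).
  move=> Ae g; have [b [_ sb]] := basis e Ae.
  exact: dependent_mod (is_ideal_subspace (idealIs e)) sb (ltnSn N).
split=> [e Ae|I|I].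
- have [b [fb sb]] := basis e Ae.
  exact: ideal_length_basis (is_ideal_subspace (idealIs e)) fb sb.
- have sI : subspace I := is_ideal_subspace (limsup_is_ideal A Is).
  (* The limsup always has codimension [k <= N], so a length at least [N] is a length equal to
     [N]. *)
  have [k [b [kN fb sb]]] := exists_basis_mod sI (limsup_dependent idealIs clA dep).
  rewrite (ideal_length_basis sI fb sb) lee_fin ler_nat; split.
    by split=> [Nk|[/eqP]]; [congr (_%:R%:E)|rewrite eqr_nat => /eqP ->]; lia.
  move=> Nk; split=> //; apply/seteqP; split; first exact: liminf_sub_limsup.
  have kE : k = N by lia.
  by move: b fb {sb}; rewrite kE => b fb; exact: limsup_sub_liminf fb dep.
- have iI : is_ideal I by exact: liminf_is_ideal.
  have sI := is_ideal_subspace iI.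
  have codim (e : nat -> Cx R) k (b : 'I_k -> holo Omega) : (forall j, A (e j)) ->
      e j @[j --> \oo] --> (0 : Cx R) ->
      spans_mod (@seq_liminf R n Omega N (fun j => a (e j))) b -> (N <= k)%N.
    move=> Ae e0; apply: seq_liminf_codim => // [j l|j|l]; [exact: aO|exact: aI|].
    exact: cvg_comp (cvg_within_sequence Ae e0) (a0 l).
  have I_seq (e : nat -> Cx R) : (forall j, A (e j)) -> e j @[j --> \oo] --> (0 : Cx R) ->
      I `<=` @seq_liminf R n Omega N (fun j => a (e j)).
    by move=> Ae e0 f; exact: liminf_along.
  have [e1 [Ae1 /small_sequence_cvg0 e10]] := closure_sequence clA.
  have fin : (ideal_length I <= N%:R%:E)%E -> exists b : 'I_N -> holo Omega,
      spans_mod I b /\ ideal_length I = N%:R%:E.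
    move=> /(ideal_length_fin sI)[k [b [kN fb sb ->]]].
    (* A family that spans modulo [I] also spans modulo the larger liminf along [e1], whose
       codimension is at least [N]. *)
    have Nk : (N <= k)%N.
      by apply: (codim e1 k b) => // f; have [c /I_seq cP] := sb f; exists c; exact: cP.
    have kE : k = N by lia.
    by move: b sb {fb}; rewrite kE => b sb; exists b.
  split; first by split=> [/fin[b [_ ->]]|->].
  move=> /fin[b [sb _]]; split=> //; apply/seteqP; split; last exact: liminf_sub_limsup.
  (* [I] is an ideal, so it suffices to treat the generators of the limsup. *)
  apply: smallest_sub => // f [e [f_ [Ae e0 If cf]]].
  have sS := @seq_liminf_subspace R n Omega N (fun j => a (e j)).
  have [c cP] := sb f.
  (* Both [f] and [f] minus the combination lie in the liminf along [e], hence so does the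
     combination. *)
  have cb : @seq_liminf R n Omega N (fun j => a (e j)) (\sum_i c i *: b i).
    rewrite -[X in seq_liminf _ X](subKr f); apply: subspaceB => //.
      by exists f_.
    exact: I_seq cP.
  have sb' : spans_mod (@seq_liminf R n Omega N (fun j => a (e j))) b.
    by move=> g; have [d dP] := sb g; exists d; exact: I_seq dP.
  (* No family of fewer than [N] functions spans modulo the liminf along [e], so [b] is free there
     and [c] vanishes. *)
  have c0 := minimal_spans_free sS sb' (fun m g => codim e m g Ae e0) cb.
  by move: cP; rewrite big1 ?subr0// => i _; rewrite c0 scale0r.
Qed.
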